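(* Let $k$ be a field, let $n$ be a positive integer coprime with the characteristic of $k$, and let $A$ be a central division algebra of degree $n$ over $k$. Let $G \subset A^*/k^*$ be a finite subgroup. Then there exists a finite subgroup $\widetilde{N}_G \subset A^*$ such that its image $N_G \subset A^*/k^*$ under the canonical projection $A^* \to A^*/k^*$ is a normal subgroup of $G$ and the quotient $G/N_G$ is an abelian group of order dividing $n^2$.
   Context: Central simple (in particular, central division) algebras over $k$ are finite-dimensional over $k$ with center $k$; the degree of $A$ is $n$ where $\dim_k A = n^2$. ''The characteristic of $k$ is coprime with $n$'' means that either $\mathrm{char}\, k = 0$ or $\mathrm{char}\, k$ does not divide $n$. By the Skolem--Noether theorem the automorphism group $\mathrm{Aut}(A)$ of the $k$-algebra $A$ is isomorphic to $A^*/k^*$. *)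

(* Defs.v *)
From HB Require Import structures.
From mathcomp Require Import all_boot all_fingroup all_algebra all_field.
From mathcomp Require Import finmap generic_quotient.

Set Implicit Arguments.
Unset Strict Implicit.
Unset Printing Implicit Defensive.

Import GRing.Theory.

Local Open Scope group_scope.
Local Open Scope quotient_scope.

(* The group of units of an arbitrary unitRingType; MathComp's {unit R} is    *)
(* restricted to finite rings.                                                *)
Section UnitGroup.

Variable R : unitRingType.

Record unit_group : predArgType := UnitGroup {
  unit_val : R;
  unit_valP : unit_val \is a GRing.unit }.

HB.instance Definition _ := [isSub for unit_val].
HB.instance Definition _ := [Choice of unit_group by <:].

Implicit Types x y z : unit_group.

Fact unit_group_mul_subproof x y :
  (unit_val x * unit_val y)%R \is a GRing.unit.
Proof. by rewrite unitrMl ?unit_valP. Qed.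

Fact unit_group_inv_subproof x : (unit_val x)^-1%R \is a GRing.unit.
Proof. by rewrite unitrV unit_valP. Qed.

Definition unit_group_one := UnitGroup (unitr1 R).
Definition unit_group_mul x y := UnitGroup (unit_group_mul_subproof x y).
Definition unit_group_inv x := UnitGroup (unit_group_inv_subproof x).

Fact unit_group_mulA : associative unit_group_mul.
Proof. by move=> x y z; apply: val_inj; rewrite /= mulrA. Qed.

Fact unit_group_mul1g : left_id unit_group_one unit_group_mul.
Proof. by move=> x; apply: val_inj; rewrite /= mul1r. Qed.

Fact unit_group_mulg1 : right_id unit_group_one unit_group_mul.
Proof. by move=> x; apply: val_inj; rewrite /= mulr1. Qed.

Fact unit_group_mulVg :
  left_inverse unit_group_one unit_group_inv unit_group_mul.
Proof. by move=> x; apply: val_inj; rewrite /= mulVr ?unit_valP. Qed.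

Fact unit_group_mulgV :
  right_inverse unit_group_one unit_group_inv unit_group_mul.
Proof. by move=> x; apply: val_inj; rewrite /= mulrV ?unit_valP. Qed.

HB.instance Definition _ := isGroup.Build unit_group
  unit_group_mulA unit_group_mul1g unit_group_mulg1
  unit_group_mulVg unit_group_mulgV.

Lemma unit_val1 : unit_val 1 = 1%R. Proof. by []. Qed.
Lemma unit_valM x y : unit_val (x * y) = (unit_val x * unit_val y)%R.
Proof. by []. Qed.
Lemma unit_valV x : unit_val x^-1 = (unit_val x)^-1%R. Proof. by []. Qed.

End UnitGroup.

(* The quotient group A^* / k^*. Here 1%VS is the line k * 1 in A, so that x  *)
(* and y are identified when x = c *: y for some scalar c, which is then      *)
(* necessarily nonzero.                                                       *)
Section ProjUnitGroup.

Variables (k : fieldType) (A : falgType k).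

Implicit Types x y z : unit_group A.

Definition scalar_unit x : bool := unit_val x \in 1%VS.

Definition scalar_equiv x y : bool := scalar_unit (x * y^-1).

Lemma scalar_unitP x :
  reflect (exists2 c : k, c != 0%R & unit_val x = (c%:A)%R) (scalar_unit x).
Proof.
apply: (iffP (vlineP _ _)) => [[c xE]|[c _ xE]]; last by exists c.
exists c => //; apply: contraTneq (unit_valP x) => c0.
by rewrite xE c0 scale0r unitr0.
Qed.

Fact scalar_unit1 : scalar_unit 1.
Proof. by apply/scalar_unitP; exists 1%R; rewrite ?oner_eq0 ?scale1r. Qed.

Fact scalar_unitM x y : scalar_unit x -> scalar_unit y -> scalar_unit (x * y).
Proof.
move=> /scalar_unitP[c c0 xE] /scalar_unitP[d d0 yE]; apply/scalar_unitP.
exists (c * d)%R; first by rewrite mulf_neq0.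
by rewrite unit_valM xE yE -scalerAl mul1r scalerA.
Qed.

Fact scalar_unitV x : scalar_unit x -> scalar_unit x^-1.
Proof.
move=> /scalar_unitP[c c0 xE]; apply/scalar_unitP; exists (c^-1)%R.
  by rewrite invr_eq0.
by rewrite unit_valV xE invrZ ?unitfE ?unitr1 // invr1.
Qed.

Fact scalar_unitC x y : scalar_unit x -> y * x = x * y.
Proof.
move=> /scalar_unitP[c c0 xE]; apply: val_inj.
by rewrite [LHS]unit_valM [RHS]unit_valM xE -scalerAl -scalerAr mulr1 mul1r.
Qed.

Fact scalar_equiv_refl : reflexive scalar_equiv.
Proof. by move=> x; rewrite /scalar_equiv divgg scalar_unit1. Qed.

Fact scalar_equiv_sym : symmetric scalar_equiv.
Proof.
by move=> x y; apply/idP/idP => /scalar_unitV; rewrite /scalar_equiv invgF.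
Qed.

Fact scalar_equiv_trans : transitive scalar_equiv.
Proof.
move=> y x z xy yz; rewrite /scalar_equiv -[x](mulgVK y) -mulgA.
exact: scalar_unitM.
Qed.

Canonical scalar_equiv_rel :=
  EquivRel scalar_equiv scalar_equiv_refl scalar_equiv_sym scalar_equiv_trans.

Definition proj_unit_group := {eq_quot scalar_equiv}.

HB.instance Definition _ := Choice.on proj_unit_group.
HB.instance Definition _ := EqQuotient.on proj_unit_group.

Definition proj_unit x : proj_unit_group := \pi_proj_unit_group x.

Lemma proj_unitP x y : (proj_unit x == proj_unit y) = scalar_unit (x * y^-1).
Proof. by rewrite /proj_unit eqmodE. Qed.

Lemma proj_unitK : cancel (repr : proj_unit_group -> unit_group A) proj_unit.
Proof. exact: reprK. Qed.

Implicit Types a b : proj_unit_group.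

Definition proj_unit_group_one : proj_unit_group := proj_unit 1.
Definition proj_unit_group_mul a b := proj_unit (repr a * repr b).
Definition proj_unit_group_inv a := proj_unit (repr a)^-1.

Fact proj_unit_mulE x y :
  proj_unit_group_mul (proj_unit x) (proj_unit y) = proj_unit (x * y).
Proof.
apply/eqP; rewrite proj_unitP invgM.
set x' := repr _; set y' := repr _.
have sx : scalar_unit (x' * x^-1) by rewrite -proj_unitP proj_unitK.
have sy : scalar_unit (y' * y^-1) by rewrite -proj_unitP proj_unitK.
have -> : x' * y' * (y^-1 * x^-1) = x' * (y' * y^-1) * x^-1 by rewrite !mulgA.
by rewrite (scalar_unitC x' sy) -mulgA scalar_unitM.
Qed.

Fact proj_unit_invE x :
  proj_unit_group_inv (proj_unit x) = proj_unit x^-1.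
Proof.
apply/eqP; rewrite proj_unitP invgK.
set x' := repr _.
have sx : scalar_unit (x * x'^-1).
  by rewrite -proj_unitP eq_sym -[proj_unit x]proj_unitK.
by rewrite -[x](mulgVK x') -(scalar_unitC x' sx) mulKg.
Qed.

Fact proj_unit_group_mulA : associative proj_unit_group_mul.
Proof.
move=> a b c; rewrite -[a]proj_unitK -[b]proj_unitK -[c]proj_unitK.
by rewrite !proj_unit_mulE mulgA.
Qed.

Fact proj_unit_group_mul1g : left_id proj_unit_group_one proj_unit_group_mul.
Proof. by move=> a; rewrite -[a]proj_unitK proj_unit_mulE mul1g. Qed.

Fact proj_unit_group_mulg1 : right_id proj_unit_group_one proj_unit_group_mul.
Proof. by move=> a; rewrite -[a]proj_unitK proj_unit_mulE mulg1. Qed.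

Fact proj_unit_group_mulVg :
  left_inverse proj_unit_group_one proj_unit_group_inv proj_unit_group_mul.
Proof.
by move=> a; rewrite -[a]proj_unitK proj_unit_invE proj_unit_mulE mulVg.
Qed.

Fact proj_unit_group_mulgV :
  right_inverse proj_unit_group_one proj_unit_group_inv proj_unit_group_mul.
Proof.
by move=> a; rewrite -[a]proj_unitK proj_unit_invE proj_unit_mulE mulgV.
Qed.

HB.instance Definition _ := isGroup.Build proj_unit_group
  proj_unit_group_mulA proj_unit_group_mul1g proj_unit_group_mulg1
  proj_unit_group_mulVg proj_unit_group_mulgV.

Fact proj_unit_monoid_morphism : monoid.monoid_morphism proj_unit.
Proof. by split=> // x y; rewrite -proj_unit_mulE. Qed.

HB.instance Definition _ :=
  isUMagmaMorphism.Build (unit_group A) proj_unit_group proj_unit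
    proj_unit_monoid_morphism.

End ProjUnitGroup.

Local Open Scope fset_scope.

(* Finite subgroups of a possibly infinite group, together with the           *)
(* finGroupType they carry.                                                   *)
Record fin_subgroup (gT : groupType) := FinSubgroup {
  fin_subgroup_set : {fset gT};
  fin_subgroup_closed : group_closed (mem fin_subgroup_set) }.

Section FinSubgroup.

Variables (gT : groupType) (G : fin_subgroup gT).

Record fin_subgroup_elt : predArgType := FinSubgroupElt {
  fin_subgroup_val : gT;
  fin_subgroup_valP : mem (fin_subgroup_set G) fin_subgroup_val }.

HB.instance Definition _ := [isSub for fin_subgroup_val].
HB.instance Definition _ := [Choice of fin_subgroup_elt by <:].
HB.instance Definition _ := SubChoice_isSubGroup.Build
  gT (mem (fin_subgroup_set G)) fin_subgroup_elt (fin_subgroup_closed G).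

Let to_fset (x : fin_subgroup_elt) : fin_subgroup_set G :=
  FSetSub (fin_subgroup_valP x).
Let of_fset (x : fin_subgroup_set G) : fin_subgroup_elt :=
  FinSubgroupElt (fsvalP x).

Fact fin_subgroup_eltK : cancel to_fset of_fset.
Proof. by move=> x; apply: val_inj. Qed.

HB.instance Definition _ :=
  Countable.copy fin_subgroup_elt (can_type fin_subgroup_eltK).
HB.instance Definition _ : isFinite fin_subgroup_elt :=
  CanIsFinite fin_subgroup_eltK.

Lemma card_fin_subgroup_elt :
  #|fin_subgroup_elt| = #|` fin_subgroup_set G|.
Proof.
rewrite cardfE; apply: (bij_eq_card (f := to_fset)).
by exists of_fset => // x; [exact: fin_subgroup_eltK | exact: val_inj].
Qed.

End FinSubgroup.

Section Image.

Variables (gT hT : groupType) (f : monoid.UMagmaMorphism.type gT hT).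
Variable N : fin_subgroup gT.

Definition fin_subgroup_image_set : {fset hT} :=
  [fset f x | x in fin_subgroup_set N].

Fact fin_subgroup_image_closed : group_closed (mem fin_subgroup_image_set).
Proof.
have [N1 ND] := fin_subgroup_closed N.
split; first by apply/imfsetP; exists 1; rewrite //= ?gmulf1.
move=> _ _ /imfsetP[x /= Nx ->] /imfsetP[y /= Ny ->].
by apply/imfsetP; exists (x * y^-1); rewrite /= ?ND ?gmulfF.
Qed.

Definition fin_subgroup_image := FinSubgroup fin_subgroup_image_closed.

End Image.

Arguments fin_subgroup_image {gT hT} f N.

(* N :&: G, viewed as a subgroup of the finite group G.                       *)
Section Relative.

Variables (gT : groupType) (G N : fin_subgroup gT).

Definition rel_subgroup_set : {set fin_subgroup_elt G} :=
  [set x | fin_subgroup_val x \in fin_subgroup_set N].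

Fact rel_subgroup_group_set : group_set rel_subgroup_set.
Proof.
have [N1 _] := fin_subgroup_closed N.
have NM := group_closedM (fin_subgroup_closed N).
apply/group_setP; split; first by rewrite inE.
by move=> x y; rewrite !inE; apply: NM.
Qed.

Canonical rel_subgroup := group rel_subgroup_group_set.

End Relative.

Local Open Scope ring_scope.

Definition central_division_algebra (k : fieldType) (A : falgType k) : Prop :=
  'Z({:A})%VS = 1%VS /\ forall x : A, x != 0 -> x \is a GRing.unit.

Definition has_degree (k : fieldType) (A : falgType k) (n : nat) : Prop :=
  \dim {:A} = (n ^ 2)%N.

Definition coprime_to_char (k : fieldType) (n : nat) : Prop :=
  forall p : nat, p \in [pchar k] -> ~~ (p %| n)%N.

(* Main.v *)
(** Let [N] be the set of the classes in [G] of elements of finite order of [A^*].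
The class of [g] lies in [N] iff the norm of [g] (determinant of the regular
representation) is a root of unity times a [dim A]-th power of [k^*], so [N] is
the kernel of a homomorphism to an abelian group; since the norms of lifts of
[N] can be made [J]-th roots of unity for a common [J], [N] has a finite lift,
and [G / N] is abelian of exponent dividing [dim A = n^2].

It remains to bound a Sylow [p]-subgroup [P] of [G], for [p] dividing [n]. The
main tool is a noncommutative version of Kneser's theorem on radical extensions:
if [P] has no exotic elements (lifts with [w ^ p = 1], or [w ^ 2 = - 1] when
[p = 2], outside of the ground field), then lifts of the elements of [P] are
linearly independent. The span of [P] is then a division subalgebra of dimension
[#|P|], which divides [dim A]. If there is an exotic element, there is one, say
[u], whose class is central in [P]; the theorem is then applied over [k(u)] to
the centraliser of [u], and what is lost by enlarging the field, namely the
elements of [P] with a lift in [k(u)], is compensated by the torsion. *)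

Require Import Defs.
From HB Require Import structures.
From mathcomp Require Import all_boot all_fingroup all_algebra all_solvable all_field.
From mathcomp Require Import finmap.
From mathcomp Require Import boolp ring.

Set Implicit Arguments.
Unset Strict Implicit.
Unset Printing Implicit Defensive.

Import GRing.Theory VectorInternalTheory.

(** * Field extensions inside a division algebra *)

Section Adjoin.

Local Open Scope ring_scope.

Variables (A : unitRingType) (A_div : forall x : A, x != 0 -> x \is a GRing.unit).

Lemma division_mulf_eq0 (x y : A) : x * y = 0 -> x = 0 \/ y = 0.
Proof.
move=> xy0; have [->|x0] := eqVneq x 0; first by left.
by right; rewrite -[y](mulKr (A_div x0)) xy0 mulr0.
Qed.

Variables (F : fieldType) (phi : {rmorphism F -> A}) (u : A).

(** A nonzero polynomial of least degree killing [u] is irreducible: a proper factorisation would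
    give two elements of [A] with product zero, so one factor of smaller degree would kill [u]. *)
Lemma exists_min_annihilator (cfu : commr_rmorph phi u) (f : {poly F}) :
  f != 0 -> horner_morph cfu f = 0 ->
  exists h : {poly F}, [/\ monic_irreducible_poly h, horner_morph cfu h = 0
                         & (size h <= size f)%N].
Proof.
have [m] := ubnP (size f); elim: m f => // m IHm f /ltnSE lefm f0 fu0.
case: (pselect (exists g : {poly F}, [/\ g != 0, horner_morph cfu g = 0
                         & (size g < size f)%N])) => [[g [g0 gu0 ltgf]]|nog].
  have [h [hI hu hg]] := IHm g (leq_trans ltgf lefm) g0 gu0.
  by exists h; split=> //; apply: leq_trans hg (ltnW ltgf).
have lf0 : lead_coef f != 0 by rewrite lead_coef_eq0.
have sz1 : (1 < size f)%N.
  rewrite ltnNge; apply/negP => /size1_polyC fE.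
  move: fu0; rewrite fE horner_morphC => /eqP; rewrite fmorph_eq0 => /eqP c0.
  by move: f0; rewrite fE c0 polyC0 eqxx.
pose h := (lead_coef f)^-1 *: f.
have szh : size h = size f by rewrite size_scale ?invr_eq0.
have hu0 : horner_morph cfu h = 0.
  by rewrite /h -mul_polyC rmorphM /= fu0 mulr0.
exists h; split=> //; last by rewrite szh.
split; last by rewrite monicE lead_coefZ mulVf.
split; first by rewrite szh.
move=> q q1 qh; have h0 : h != 0 by rewrite scaler_eq0 negb_or invr_eq0 lf0.
have q0 : q != 0 by apply: contraNneq h0 => q0; rewrite q0 dvd0p in qh.
have hE := divpK qh.
have g0 : h %/ q != 0 by apply: contraNneq h0 => g0; rewrite -hE g0 mul0r.
have szM : size h = (size (h %/ q) + size q).-1 by rewrite -hE size_mul // hE.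
have small g : g != 0 -> horner_morph cfu g = 0 -> (size f <= size g)%N.
  by move=> g0' gu; rewrite leqNgt; apply/negP => lt; apply: nog; exists g.
have: horner_morph cfu (h %/ q * q) = 0 by rewrite hE.
rewrite rmorphM /= => /division_mulf_eq0[] /small.
  move=> /(_ g0); rewrite -szh szM => le; case/negP: q1.
  move: g0 q0 le; rewrite -!size_poly_eq0; case: (size (_ %/ _)) => // a.
  case: (size q) => // b _ _.
  by rewrite addnS /= -ltnS -addnS -[X in (_ <= X)%N]addn1 leq_add2l ltnS leqn0 eqSS.
move=> /(_ q0) le; rewrite -(dvdp_size_eqp qh) eqn_leq dvdp_leq ?h0 //=.
by rewrite szh.
Qed.

(** Take for [L] the field [F[X]/(h)] with [h] irreducible and killing [u], and for [psi] the
    evaluation at [u]. The third and fourth conclusions say that the powers of [x] below the degree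
    form a basis. Since [F] enters only through [phi], the construction can be iterated with [psi],
    whose image need not be central. *)
Lemma adjoin_root (f : {poly F}) :
    commr_rmorph phi u -> f != 0 -> (map_poly phi f).[u] = 0 ->
  exists (L : fieldExtType F) (psi : {rmorphism L -> A}) (x : L),
    [/\ psi x = u,
        forall c, psi (c%:A) = phi c,
        forall y : L, exists2 g : {poly F}, (size g <= \dim {:L})%N
          & y = (map_poly (in_alg L) g).[x],
        forall g : {poly F}, (size g <= \dim {:L})%N ->
          (map_poly (in_alg L) g).[x] = 0 -> g = 0
      & (\dim {:L} < size f)%N].
Proof.
move=> cfu f0 fu0.
have [h [hI hu0 szh]] := exists_min_annihilator (cfu := cfu) f0 fu0.
have hM : mk_monic h = h by apply: mk_monicE.
pose L : fieldExtType F := {poly %/ h with hI}.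
have modE q : (in_qpoly h q : {poly F}) = q %% h.
  by rewrite /= hM -Pdiv.IdomainMonic.modpE ?hI.2.
pose toA (q : L) : A := horner_morph cfu (q : {poly F}).
have toA_in q : toA (in_qpoly h q) = horner_morph cfu q.
  by rewrite /toA modE {2}(divp_eq q h) rmorphD rmorphM /= hu0 mulr0 add0r.
have toA_add : zmod_morphism toA.
  by move=> p q; rewrite /toA -rmorphB.
have inK (y : L) : in_qpoly h (y : {poly F}) = y.
  by apply/val_inj/in_qpoly_small; exact: size_mk_monic.
have toA_mul : GRing.monoid_morphism toA.
  split; first by rewrite -(in_qpoly1 h) toA_in rmorph1.
  by move=> p q; rewrite -(inK p) -(inK q) -in_qpolyM !toA_in rmorphM.
pose psi : {rmorphism L -> A} := HB.pack toA
  (GRing.isZmodMorphism.Build L A toA toA_add)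
  (GRing.isMonoidMorphism.Build L A toA toA_mul).
have inC c : in_qpoly h c%:P = c%:A :> L.
  by rewrite -[c%:P]mulr1 mul_polyC in_qpolyZ in_qpoly1.
have evE g : (map_poly (in_alg L) g).[in_qpoly h 'X : L] = in_qpoly h g.
  elim/poly_ind: g => [|g c IH]; first by rewrite rmorph0 horner0 in_qpoly0.
  rewrite rmorphD rmorphM /= map_polyX map_polyC hornerMXaddC IH.
  by rewrite in_qpolyD in_qpolyM inC.
have dimL : \dim {:L} = (size h).-1 by rewrite /L /= dim_polyn hM.
have h_gt1 := hI.1.1.
exists L, psi, (in_qpoly h 'X); split.
- by rewrite [psi _]toA_in horner_morphX.
- by move=> c; rewrite -inC [psi _]toA_in horner_morphC.
- move=> y; exists (y : {poly F}); last by rewrite evE inK.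
  by rewrite dimL -ltnS prednK ?(ltnW h_gt1) //; apply: leq_trans (size_mk_monic y) _; rewrite hM.
- move=> g; rewrite dimL => szg; rewrite evE => g0.
  rewrite -[g](@modp_small _ _ h) -?modE ?g0 //.
  by rewrite -ltnS prednK ?(ltnW h_gt1) in szg.
- by rewrite dimL prednK ?(ltnW h_gt1).
Qed.

End Adjoin.

(** * Norm and trace of the regular representation *)

Section RegularNorm.

Local Open Scope ring_scope.

Variables (F : fieldType) (A : falgType F).
Implicit Types x y : A.

Definition regmx y : 'M[F]_(dim A) := (f2mx (amulr y))^T.
Definition regnorm y := \det (regmx y).
Definition regtrace y := \tr (regmx y).

(* [v2r] produces row vectors, hence the transpose: [regmx y] acts on columns, *)
(* and so on the eigenvector of [root_regmx_char_poly]. *)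
Lemma v2rM x y : v2r (x * y) = v2r x *m (regmx y)^T.
Proof.
rewrite trmxK; have <- : amulr y x = x * y by rewrite lfunE.
by rewrite unlock /= r2vK.
Qed.

Lemma regmxP y (M : 'M_(dim A)) :
  (forall x, v2r (x * y) = v2r x *m M^T) -> M = regmx y.
Proof.
move=> yM; apply: trmx_inj; apply/row_matrixP => i.
by rewrite !rowE -[delta_mx 0 i](@r2vK _ A) -v2rM -yM.
Qed.

Lemma regnormM x y : regnorm (x * y) = regnorm x * regnorm y.
Proof.
rewrite mulrC /regnorm -det_mulmx; congr (\det _); symmetry.
by apply: regmxP => z; rewrite mulrA !v2rM trmx_mul mulmxA.
Qed.

Lemma regmxZ c y : regmx (c *: y) = c *: regmx y.
Proof.
symmetry; apply: regmxP => z.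
by rewrite -scalerAr linearZ /= v2rM linearZ /= -scalemxAr.
Qed.

Lemma regmx1 : regmx 1 = 1%:M.
Proof. by symmetry; apply: regmxP => z; rewrite mulr1 trmx1 mulmx1. Qed.

Lemma regnorm1 : regnorm 1 = 1.
Proof. by rewrite /regnorm regmx1 det1. Qed.

Lemma regnormX y i : regnorm (y ^+ i) = regnorm y ^+ i.
Proof.
by elim: i => [|i IH]; rewrite ?expr0 ?regnorm1 // !exprS regnormM IH.
Qed.

Lemma regnormZ c y : regnorm (c *: y) = c ^+ \dim {:A} * regnorm y.
Proof. by rewrite /regnorm regmxZ detZ dimvf. Qed.

Lemma regnormA c : regnorm c%:A = c ^+ \dim {:A}.
Proof. by rewrite regnormZ regnorm1 mulr1. Qed.

Lemma regtraceZ c y : regtrace (c *: y) = c * regtrace y.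
Proof. by rewrite /regtrace regmxZ linearZ. Qed.

Lemma regtrace1 : regtrace 1 = (\dim {:A})%:R.
Proof. by rewrite /regtrace regmx1 mxtrace1 dimvf. Qed.

Lemma regtraceD x y : regtrace (x + y) = regtrace x + regtrace y.
Proof.
rewrite /regtrace -linearD /=; congr (\tr _); symmetry.
by apply: regmxP => z; rewrite mulrDr linearD /= !v2rM linearD /= mulmxDr.
Qed.

Lemma regtrace_sum (I : Type) (r : seq I) (f : I -> A) :
  regtrace (\sum_(i <- r) f i) = \sum_(i <- r) regtrace (f i).
Proof.
apply: (big_morph regtrace regtraceD).
by rewrite -(scale0r 0) regtraceZ mul0r.
Qed.

Lemma regnorm_neq0 y : y \is a GRing.unit -> regnorm y != 0.
Proof.
move=> Uy; apply/eqP => N0.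
have := regnormM y y^-1; rewrite divrr // regnorm1 N0 mul0r => /eqP.
by rewrite oner_eq0.
Qed.

End RegularNorm.

(** * Characteristic polynomials of radical elements in extensions of prime degree *)

Section PrimeDegree.

Local Open Scope ring_scope.

(** The row formed by a basis of [L] over [F] is an eigenvector, over [L], of the matrix of
    multiplication by [y], with eigenvalue [y]. *)
Lemma root_regmx_char_poly (F : fieldType) (L : fieldExtType F) (y : L) :
  root (map_poly (in_alg L) (char_poly (regmx y))) y.
Proof.
rewrite map_char_poly -eigenvalue_root_char; apply/eigenvalueP.
pose e i : L := r2v (delta_mx 0 i).
exists (\row_i e i); last first.
  apply/eqP => /rowP/(_ (Ordinal (FalgType_proper L))); rewrite !mxE /e.
  move=> /(congr1 v2r); rewrite r2vK linear0 => /rowP/(_ (Ordinal (FalgType_proper L))).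
  by rewrite !mxE !eqxx => /eqP; rewrite oner_eq0.
have eE i j : v2r (e j * y) 0 i = f2mx (amulr y) j i.
  by rewrite v2rM r2vK -rowE !mxE.
apply/rowP => j; rewrite !mxE mulrC -[e j * y]v2rK.
rewrite [v2r _]row_sum_delta linear_sum.
apply: eq_bigr => i _.
by rewrite linearZ /= !mxE -/(e i) eE mulr_algr.
Qed.

Variables (F : fieldType) (L : fieldExtType F) (p : nat).
Hypotheses (p_pr : prime p) (dimL : \dim {:L} = p).

(** As [p] is prime, [y] generates [L] and its minimal polynomial has degree [p]. The difference of
    the two monic polynomials of degree [p] has smaller degree and vanishes at [y], so it is
    zero. *)
Lemma char_poly_radical (y : L) (c : F) :
  y \notin 1%VS -> y ^+ p = c%:A -> char_poly (regmx y) = 'X^p - c%:P.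
Proof.
move=> yF yp; have p_gt0 := prime_gt0 p_pr.
have szy : size (minPoly 1 y) = p.+1.
  rewrite size_minPoly; congr S.
  have /primeP[_ /(_ (adjoin_degree 1 y))] := p_pr.
  rewrite adjoin_deg_eq1 (negPf yF) => /(_ _)/eqP-> //.
  rewrite adjoin_degreeE dimv1 divn1 -dimL.
  by have := field_dimS (subvf <<1; y>>%AS).
apply/eqP; rewrite -subr_eq0; set r := _ - _; apply: contraT => r0.
have dimA : dim L = p by rewrite -dimL dimvf.
have szr : (size r <= p)%N.
  rewrite -ltnS ltn_neqAle andbC.
  have szc : size (char_poly (regmx y)) = p.+1 by rewrite size_char_poly dimA.
  have szX : size ('X^p - c%:P : {poly F}) = p.+1 by rewrite size_XnsubC.
  have szr : (size r <= p.+1)%N.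
    by rewrite (leq_trans (size_polyD _ _)) // size_polyN szc szX maxnn.
  rewrite szr; apply/eqP => szrp.
  have : lead_coef r = 0.
    have := char_poly_monic (regmx y); rewrite monicE /lead_coef szc => /eqP /= mc.
    have := monicXnsubC c p_gt0; rewrite monicE /lead_coef szX => /eqP /= mX.
    by rewrite /lead_coef szrp /= coefB mc mX subrr.
  by move/eqP; rewrite lead_coef_eq0 (negPf r0).
have : minPoly 1 y %| map_poly (in_alg L) r.
  apply: minPoly_dvdp; first exact/alg_polyOver.
  have := root_regmx_char_poly y; rewrite rmorphB /= rmorphB /= map_polyXn map_polyC /=.
  by rewrite /root !hornerE yp subrr subr0.
move/dvdp_leq; rewrite map_poly_eq0 r0 szy size_map_poly => /(_ isT).
by rewrite ltnNge szr.
Qed.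

Lemma regnorm_radical (y : L) (c : F) :
  y \notin 1%VS -> y ^+ p = c%:A -> regnorm y = (-1) ^+ p.+1 * c.
Proof.
move=> yF yp; have dimA : dim L = p by rewrite -dimL dimvf.
have : (char_poly (regmx y))`_0 = (-1) ^+ p * regnorm y.
  by rewrite char_poly_det -[in RHS]dimA.
rewrite (char_poly_radical yF yp).
rewrite coefB coefXn coefC eqxx eq_sym (negPf (lt0n_neq0 (prime_gt0 p_pr))) sub0r.
move=> /(congr1 ( *%R ((-1) ^+ p))); rewrite mulrA -expr2 sqrr_sign mul1r.
by rewrite exprSr -mulrA mulN1r => <-.
Qed.

Lemma regtrace_radical (y : L) (c : F) :
  y \notin 1%VS -> y ^+ p = c%:A -> regtrace y = 0.
Proof.
move=> yF yp; have dimA : dim L = p by rewrite -dimL dimvf.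
have : (char_poly (regmx y))`_p.-1 = - regtrace y.
  by rewrite -[in LHS]dimA char_poly_trace // FalgType_proper.
rewrite (char_poly_radical yF yp) coefB coefXn coefC.
have := prime_gt1 p_pr; case: (p) => [|[|q]] //= _.
by rewrite ltn_eqF // subr0 => /eqP; rewrite eq_sym oppr_eq0 => /eqP.
Qed.

End PrimeDegree.

(** * Radical elements of an extension generated by a [p]-th root *)

Section RadicalExtension.

Local Open Scope ring_scope.

(** Bezout gives [u * i = v * p + 1], and then [a] is the [p]-th power of [nu ^+ u / a ^+ v]; for
    [i = 0], coprimality forces [p = 1]. *)
Lemma coprime_power_root (F : fieldType) (p i : nat) (a nu : F) :
  a != 0 -> coprime i p -> nu ^+ p = a ^+ i -> exists b, b ^+ p = a.
Proof.
case: i => [|i] a0 co nup.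
  move: co; rewrite /coprime gcd0n => /eqP p1.
  by exists a; rewrite p1 expr1.
case: (@egcdnP i.+1 p isT) => u v uv _.
exists (nu ^+ u / a ^+ v); rewrite expr_div_n exprAC nup -!exprM [(i.+1 * u)%N]mulnC uv.
by rewrite (eqP co) exprD expr1 mulrAC divff ?mul1r // expf_neq0.
Qed.

Variables (F : fieldType) (L : fieldExtType F) (p : nat) (x : L) (a : F).
Hypotheses (p_pr : prime p) (dimL : \dim {:L} = p) (pF : p%:R != 0 :> F).
Hypothesis xp : x ^+ p = a%:A.
Hypothesis a_pow : forall b, b ^+ p != a.
Hypothesis a_sqr : p = 2%N -> forall b, b ^+ 2 != - a.

Let a0 : a != 0.
Proof. by apply: contraNneq (a_pow 0) => ->; rewrite expr0n eqn0Ngt prime_gt0. Qed.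

Let inA_inj : injective (in_alg L) := fmorph_inj _.

Let x0 : x != 0.
Proof.
apply: contraNneq a0 => x0; move/eqP: xp.
by rewrite x0 expr0n eqn0Ngt prime_gt0 //= eq_sym scaler_eq0 oner_eq0 orbF.
Qed.

Lemma radical_expr_notin i : ~~ (p %| i)%N -> x ^+ i \notin 1%VS.
Proof.
move=> pi; apply/negP => /vlineP[b xb].
have co : coprime i p by rewrite coprime_sym prime_coprime.
have bp : b ^+ p = a ^+ i.
  by apply: inA_inj; rewrite !rmorphXn /= -xb -xp exprAC.
by have [c /eqP] := coprime_power_root a0 co bp; apply/negP.
Qed.

Let xF : x \notin 1%VS.
Proof.
by apply: (@radical_expr_notin 1); rewrite dvdn1 neq_ltn prime_gt1 ?orbT.
Qed.

(* Taking norms: [N x = +- a] is not a [p]-th power, while [N y ^ p = c ^ p * N x ^ i]. *)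
Lemma radical_exponent_dvd (y : L) c i :
  y != 0 -> y ^+ p = c%:A * x ^+ i -> (p %| i)%N.
Proof.
move=> y0 yp; apply: contraT => pi.
have c0 : c != 0.
  apply: contraNneq (expf_neq0 p y0) => c0.
  by rewrite yp c0 scale0r mul0r.
have := congr1 (@regnorm _ _) yp.
rewrite regnormM !regnormX regnormA dimL (regnorm_radical p_pr dimL xF xp) => Ny.
set a' := _ * a in Ny.
have a'0 : a' != 0 by rewrite mulf_neq0 ?signr_eq0.
have co : coprime i p by rewrite coprime_sym prime_coprime.
have nu_p : (regnorm y / c) ^+ p = a' ^+ i.
  by rewrite expr_div_n Ny mulrAC divff ?mul1r // expf_neq0.
have [b ba'] := coprime_power_root a'0 co nu_p.
have [p2|odd_p] := even_prime p_pr.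
  by case/negP: (a_sqr p2 b); rewrite -[X in b ^+ X]p2 ba' /a' p2 -signr_odd expr1 mulN1r.
case/negP: (a_pow b); by rewrite ba' /a' -signr_odd /= odd_p expr0 mul1r.
Qed.

(* Elements outside of [F] whose [p]-th power is in [F] have trace [0]; if [x ^ j] *)
(* occurs in [y], then [y / x ^ j] has nonzero trace and is thus a scalar. *)
Lemma radical_power_monomial (y : L) c i :
    (exists2 g : {poly F}, (size g <= p)%N & y = (map_poly (in_alg L) g).[x]) ->
  y ^+ p = c%:A * x ^+ i -> exists d j, y = d%:A * x ^+ j.
Proof.
move=> [g szg yE] yp; have [y0|y0] := eqVneq y 0.
  by exists 0, 0%N; rewrite y0 scale0r mul0r.
have /dvdnP[l il] := radical_exponent_dvd y0 yp.
have {il i}yp : y ^+ p = (c * a ^+ l)%:A.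
  by rewrite yp il mulnC exprM xp -[a%:A]/(in_alg L a) -rmorphXn /= -scalerAl mul1r scalerA.
have yS : y = \sum_(j < p) g`_j *: x ^+ j.
  rewrite yE (@horner_coef_wide _ p) ?size_map_poly //.
  by apply: eq_bigr => j _; rewrite coef_map mulr_algl.
have [j gj0] : exists j : 'I_p, g`_j != 0.
  apply/existsP; apply: contraNT y0; rewrite negb_exists => /forallP g0.
  by rewrite yS big1 // => j _; move/negPn/eqP: (g0 j) => ->; rewrite scale0r.
have zp : (y / x ^+ j) ^+ p = (c * a ^+ l / a ^+ j)%:A.
  rewrite expr_div_n yp exprAC xp -[a%:A]/(in_alg L a) -rmorphXn.
  by rewrite -[(_ / _)%:A]/(in_alg L _) fmorph_div.
have [/vlineP[d zd]|zF] := boolP (y / x ^+ j \in 1%VS).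
  by exists d, j; rewrite -zd divfK // expf_neq0.
(* The trace picks out the coefficient of [x ^+ j]: after the division the other terms are multiples
   of [x ^+ (m - j)] with [0 < |m - j| < p], hence outside of [F] and of trace zero. *)
have : regtrace (y / x ^+ j) = p%:R * g`_j.
  rewrite yS mulr_suml regtrace_sum (bigD1 j) //= -scalerAl divff ?expf_neq0 //.
  rewrite regtraceZ regtrace1 dimL big1 ?addr0 1?mulrC // => m mj.
  rewrite -scalerAl regtraceZ.
  rewrite (@regtrace_radical _ _ _ p_pr dimL _ (a ^+ m / a ^+ j)) ?mulr0 //; last first.
    rewrite expr_div_n ![_ ^+ _ ^+ p]exprAC xp -[a%:A]/(in_alg L a) -!rmorphXn.
    by rewrite -[(_ / _)%:A]/(in_alg L _) fmorph_div.
  have [ltmj|] := ltnP m j; last first.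
    rewrite leq_eqVlt eq_sym val_eqE (negPf mj) /= => ltjm.
    rewrite -expfB //; apply: radical_expr_notin.
    by rewrite gtnNdvd ?subn_gt0 // (leq_ltn_trans (leq_subr _ _)).
  rewrite -[_ / _]invrK invf_div -expfB // memvV; apply: radical_expr_notin.
  by rewrite gtnNdvd ?subn_gt0 // (leq_ltn_trans (leq_subr _ _)).
rewrite (regtrace_radical p_pr dimL zF zp) => /eqP.
by rewrite eq_sym mulf_eq0 (negPf pF) (negPf gj0).
Qed.

End RadicalExtension.

(** * Projective representations *)

Section ProjectiveRepresentation.

Local Open Scope ring_scope.

Variables (A : unitRingType) (A_div : forall x : A, x != 0 -> x \is a GRing.unit).
Variables (gT : finGroupType) (rho : gT -> A).
Hypothesis rho_neq0 : forall x, rho x != 0.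

Let rho_unit x : rho x \is a GRing.unit. Proof. exact: A_div. Qed.

Definition projective_over (F : fieldType) (phi : {rmorphism F -> A}) :=
  forall x y, exists c, rho x * rho y = phi c * rho (x * y)%g.

(* The coefficients are on the left: [phi F] need not commute with [rho]. *)
Definition independent_mod (F : fieldType) (phi : {rmorphism F -> A})
    (P X : {set gT}) :=
  forall (R : {set gT}) (a : gT -> F), R \subset P ->
    {in R &, forall x y, (x * y^-1)%g \in X -> x = y} ->
    \sum_(x in R) phi (a x) * rho x = 0 -> {in R, forall x, a x = 0}.

Section Basics.

Variables (F : fieldType) (phi : {rmorphism F -> A}).
Hypothesis rhoM : projective_over phi.

Lemma division_fmorph_unit c : c != 0 -> phi c \is a GRing.unit.
Proof. by move=> c0; rewrite A_div // fmorph_eq0. Qed.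

Lemma projM x y : exists2 c, c != 0 & rho (x * y)%g = phi c * (rho x * rho y).
Proof.
have [c xy] := rhoM x y; have c0 : c != 0.
  apply: contraTneq (rho_unit x) => c0; move/eqP: xy.
  rewrite c0 rmorph0 mul0r -(mul0r (rho y)) (inj_eq (mulIr (rho_unit y))) => /eqP->.
  by rewrite unitr0.
exists c^-1; rewrite ?invr_eq0 // xy mulrA -rmorphM mulVf // rmorph1 mul1r //.
Qed.

Lemma proj_one : exists c, rho 1%g = phi c.
Proof.
by have [c] := rhoM 1%g 1%g; rewrite mulg1 => /(mulIr (rho_unit _)) ->; exists c.
Qed.

Lemma projX x i : exists2 c, c != 0 & rho x ^+ i = phi c * rho (x ^+ i)%g.
Proof.
elim: i => [|i [c c0 IH]].
  have [c r1] := proj_one; exists c^-1.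
    by rewrite invr_eq0 -(fmorph_eq0 phi) -r1.
  by rewrite r1 -rmorphM mulVf ?rmorph1 // -(fmorph_eq0 phi) -r1.
have [d d0 xM] := projM (x ^+ i)%g x; exists (c / d); first by rewrite mulf_neq0 ?invr_eq0.
by rewrite exprSr IH expgSr xM !mulrA -rmorphM divfK.
Qed.

Lemma projMV x y : exists2 c, c != 0 & rho (x * y^-1)%g = phi c * (rho x / rho y).
Proof.
have [c c0 xy] := projM (x * y^-1)%g y; exists c^-1; rewrite ?invr_eq0 //.
rewrite mulgKV in xy; rewrite xy !mulrA -rmorphM mulVf // rmorph1 mul1r.
by rewrite mulrK.
Qed.

(** This provides the subgroup modulo which lifts are to be independent: two elements that agree
    modulo it have lifts proportional over [phi F]. *)
Lemma field_subgroup (C : {group gT}) :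
    {in C, forall x c, phi c * rho x = rho x * phi c} ->
  exists X : {group gT}, X \subset C /\
    {in C, forall x, x \in X <-> exists c, rho x = phi c}.
Proof.
move=> phiC; pose X := [set x in C | `[< exists c, rho x = phi c >]].
have gX : group_set X.
  apply/group_setP; split; first by rewrite inE group1; apply/asboolP/proj_one.
  move=> x y; rewrite !inE => /andP[Cx /asboolP[c xc]] /andP[Cy /asboolP[d yd]].
  rewrite groupM //; apply/asboolP; have [e _ ->] := projM x y.
  by rewrite xc yd; exists (e * (c * d)); rewrite !rmorphM.
exists (group gX); split; first by apply/subsetP => x; rewrite inE => /andP[].
by move=> x Cx; rewrite inE Cx; split=> [/asboolP|?] //; apply/asboolP.
Qed.

Lemma centraliser_subgroup (u : A) (P : {group gT}) :
    (forall c, phi c * u = u * phi c) ->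
  exists C : {group gT}, C \subset P /\
    {in P, forall y, (y \in C) = (rho y * u == u * rho y)}.
Proof.
move=> phiu; pose C := [set y in P | rho y * u == u * rho y].
have gC : group_set C.
  apply/group_setP; split.
    rewrite inE group1; have [c ->] := proj_one.
    by rewrite phiu eqxx.
  move=> y t; rewrite !inE => /andP[Py /eqP yu] /andP[Pt /eqP tu].
  rewrite groupM //=; have [c _ ->] := projM y t; apply/eqP.
  by rewrite -!mulrA tu [in LHS](mulrA (rho y)) yu !mulrA phiu.
exists (group gC); split; first by apply/subsetP => y; rewrite inE => /andP[].
by move=> y Py; rewrite inE Py.
Qed.

Lemma projC x y : (x * y = y * x)%g ->
  exists2 c, c != 0 & rho x * rho y = phi c * (rho y * rho x).
Proof.
move=> xy; have [c c0 E1] := projM x y; have [d d0 E2] := projM y x.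
exists (c^-1 * d); first by rewrite mulf_neq0 ?invr_eq0.
rewrite rmorphM -mulrA -E2 -xy E1 mulrA -rmorphM mulVf // rmorph1 mul1r //.
Qed.

End Basics.

(* Lagrange interpolation in the eigenvalues of the conjugation by [u]. *)
Lemma eigenvector_sum (F : fieldType) (phi : {rmorphism F -> A}) (u : A)
    (I : finType) (R : {set I}) (v : I -> A) (chi : I -> F) :
    u != 0 -> (forall c, phi c * u = u * phi c) ->
    {in R, forall i, u * v i = phi (chi i) * v i * u} ->
    \sum_(i in R) v i = 0 ->
  forall c, \sum_(i in R | chi i == c) v i = 0.
Proof.
move=> u0 phiu uv v0 c; have Uu := A_div u0.
(* Conjugating the relation by [u] multiplies its [i]-th term by [chi i]; repeated, this allows the
   terms to be weighted by any polynomial in [chi i]. *)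
have polyv (q : {poly F}) : \sum_(i in R) phi q.[chi i] * v i = 0.
  have expv j : \sum_(i in R) phi (chi i ^+ j) * v i = 0.
    elim: j => [|j IH].
      by rewrite -[RHS]v0; apply: eq_bigr => i _; rewrite expr0 rmorph1 mul1r.
    have uIH := congr1 ( *%R u) IH; rewrite mulr0 mulr_sumr in uIH.
    apply: (mulIr Uu); rewrite mul0r -[RHS]uIH mulr_suml.
    apply: eq_bigr => i Ri; rewrite [RHS]mulrA -phiu -[RHS]mulrA uv // !mulrA -rmorphM.
    by rewrite -exprSr.
  under eq_bigr => i _ do rewrite horner_coef rmorph_sum mulr_suml.
  rewrite exchange_big big1 // => j _.
  under eq_bigr => i _ do rewrite rmorphM -mulrA.
  by rewrite -mulr_sumr expv mulr0.
pose q := \prod_(i in R | chi i != c) ('X - (chi i)%:P).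
have q0 i : i \in R -> chi i != c -> q.[chi i] = 0.
  move=> Ri ic; apply/eqP; rewrite horner_prod prodf_seq_eq0; apply/hasP.
  by exists i; rewrite ?mem_index_enum //= Ri ic !hornerE subrr /=.
have qc : q.[c] != 0.
  rewrite horner_prod prodf_seq_neq0; apply/allP => i _; apply/implyP => /andP[_ ic].
  by rewrite !hornerE subr_eq0 eq_sym.
apply: (mulrI (division_fmorph_unit phi qc)); rewrite mulr0 -[RHS](polyv q).
rewrite [RHS](bigID (fun i => chi i == c)) /= [X in _ + X]big1 ?addr0.
  by rewrite mulr_sumr; apply: eq_bigr => i /andP[_ /eqP->].
by move=> i /andP[Ri ic]; rewrite q0 // rmorph0 mul0r.
Qed.

(** Each [rho x] is an eigenvector of conjugation by [u], so a relation splits along the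
    eigenvalues. Elements with the eigenvalue of [x0] lie in the coset of [x0] modulo [C]; dividing
    on the right by [rho x0] gives a relation within [C]. *)
Lemma independent_mod_centraliser (F L : fieldType)
    (phi : {rmorphism F -> A}) (psi : {rmorphism L -> A})
    (u : A) (P C : {group gT}) (X : {set gT}) :
    u != 0 -> projective_over phi ->
    (forall c, exists d, phi c = psi d) ->
    {in P, forall x c, phi c * rho x = rho x * phi c} ->
    (forall l, psi l * u = u * psi l) ->
    {in P, forall x, exists c, u * rho x = phi c * rho x * u} ->
    {in P, forall x, u * rho x = rho x * u -> x \in C} ->
  independent_mod psi C X -> independent_mod psi P X.
Proof.
move=> u0 rhoM phipsi phiP psiu uP CP indC R a RP Rsep Ra0 x0 Rx0.
have Px x : x \in R -> x \in P by apply/subsetP.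
have [chi chiE] : exists chi : gT -> F,
    forall x, x \in P -> u * rho x = phi (chi x) * rho x * u.
  apply: (fin_all_exists (P := fun x c => x \in P -> u * rho x = phi c * rho x * u)) => x.
  by have [/uP[c]|] := boolP (x \in P); [exists c | exists 0].
have phiL c l : phi c * psi l = psi l * phi c.
  by have [d ->] := phipsi c; rewrite -!rmorphM mulrC.
have phiu c : phi c * u = u * phi c by have [d ->] := phipsi c.
have Ra1 : \sum_(x in R | chi x == chi x0) psi (a x) * rho x = 0.
  apply: (eigenvector_sum (phi := phi) u0 phiu) Ra0 _ => x Rx.
  by rewrite mulrA -psiu -mulrA chiE ?Px // !mulrA phiL.
have [k kE] : exists k : gT -> L, forall x,
    k x != 0 /\ rho x = psi (k x) * rho (x * x0^-1)%g * rho x0.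
  apply: (fin_all_exists (P := fun x c => c != 0 /\ rho x = psi c * rho (x * x0^-1)%g * rho x0)) => x.
  have [c c0] := projM rhoM (x * x0^-1)%g x0; rewrite mulgKV => ->.
  have [d cd] := phipsi c; exists d; split; last by rewrite cd mulrA.
  by rewrite -(fmorph_eq0 psi) -cd fmorph_eq0.
pose R1 := [set (x * x0^-1)%g | x in [set x in R | chi x == chi x0]].
pose a1 y := a (y * x0)%g * k (y * x0)%g.
have x0R1 : 1%g \in R1 by apply/imsetP; exists x0; rewrite ?inE ?Rx0 ?eqxx ?mulgV.
suff /(_ 1%g x0R1)/eqP : {in R1, forall y, a1 y = 0}.
  by rewrite /a1 mul1g mulf_eq0 (negPf (kE _).1) orbF => /eqP.
apply: indC.
- apply/subsetP => _ /imsetP[x /[!inE] /andP[Rx /eqP xx0] ->].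
  apply: CP; first by rewrite groupM ?groupV ?Px.
  have [kx0 kxE] := kE x; set y := (x * x0^-1)%g in kxE *.
  have Py : y \in P by rewrite groupM ?groupV ?Px.
  apply: (mulrI (division_fmorph_unit psi kx0)); apply: (mulIr (rho_unit x0)).
  rewrite !mulrA psiu -2!mulrA [_ * (_ * rho x0)]mulrA -kxE chiE ?Px // xx0 kxE.
  rewrite !mulrA phiL -!mulrA; congr (_ * _).
  by rewrite mulrA phiP // -mulrA; congr (_ * _); rewrite chiE ?Px // mulrA.
- move=> _ _ /imsetP[x /[!inE] /andP[Rx _] ->] /imsetP[y /[!inE] /andP[Ry _] ->].
  rewrite invMg invgK -mulgA mulKg => xy.
  by rewrite (Rsep x y).
- rewrite big_imset /=; last by move=> x y _ _ /mulIg.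
  apply: (mulIr (rho_unit x0)); rewrite mul0r mulr_suml -[RHS]Ra1.
  apply: eq_big => [x|x]; rewrite ?inE // => _.
  by rewrite /a1 mulgKV rmorphM -!mulrA [psi (k x) * _]mulrA -(kE x).2.
Qed.

End ProjectiveRepresentation.

(** The nontrivial [p]-group [P / X] has a nontrivial center, by Cauchy with an element of order
    [p]; [z] is a representative of it. *)
Lemma central_mod_normal (gT : finGroupType) (p : nat) (P X : {group gT}) :
    (p.-group P)%g -> (X <| P)%g -> ~~ (P \subset X) ->
  exists z, [/\ z \in P, z \notin X, (z ^+ p)%g \in X
              & {in P, forall y, [~ z, y]%g \in X}].
Proof.
move=> pP nXP PX; have [sXP nXP'] := andP nXP.
have ntQ : (P / X != 1)%g by rewrite -subG1 quotient_sub1.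
have pQ : (p.-group (P / X))%g by rewrite quotient_pgroup.
have pZ : (p.-group 'Z(P / X))%g by apply: pgroupS pQ; apply: center_sub.
have ntZ : ('Z(P / X) != 1)%g by rewrite (center_nil_eq1 (pgroup_nil pQ)).
have [p_pr pdZ _] := pgroup_pdiv pZ ntZ.
have [zb /centerP[Qz cQz] oz] := Cauchy p_pr pdZ.
have [z Nz Pz zbE] := morphimP Qz; exists z.
split=> //.
- apply: contraTN (prime_gt1 p_pr) => Xz.
  by rewrite -oz (_ : zb = 1%g) ?order1 // zbE; apply: coset_id.
- by apply: coset_idr; rewrite ?groupX // morphX // -zbE -oz expg_order.
- move=> y Py; have Ny := subsetP nXP' y Py.
  apply: coset_idr; rewrite ?groupR //.
  rewrite morphR //= -zbE; apply/eqP/commgP; apply: cQz.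
  exact: mem_quotient.
Qed.

(** * A noncommutative Kneser theorem *)

Section NoncommutativeKneser.

Local Open Scope ring_scope.

Lemma adjoin_commute (A : unitRingType) (F : fieldType) (L : fieldExtType F)
    (phi : {rmorphism F -> A}) (psi : {rmorphism L -> A}) (x l : L) (w : A) :
    (forall c, psi c%:A = phi c) ->
    (exists2 g : {poly F}, (size g <= \dim {:L})%N & l = (map_poly (in_alg L) g).[x]) ->
    (forall c, phi c * w = w * phi c) -> psi x * w = w * psi x ->
  psi l * w = w * psi l.
Proof.
move=> psiA [g _ ->] phiw xw; rewrite -horner_map -map_poly_comp horner_coef.
rewrite mulr_suml mulr_sumr; apply: eq_bigr => i _.
rewrite coef_map /= psiA mulrA -phiw -!mulrA; congr (_ * _).
exact/esym/commrX/esym.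
Qed.

Variables (A : unitRingType) (A_div : forall x : A, x != 0 -> x \is a GRing.unit).

Lemma division_sqr_eq (v w : A) : v * w = w * v -> v ^+ 2 = w ^+ 2 -> v = w \/ v = - w.
Proof.
move=> vw v2; have := subrXX_comm 2 vw; rewrite v2 subrr !big_ord_recl big_ord0.
rewrite addr0 /= subnn !expr0 !expr1 mulr1 mul1r => /esym.
case/(division_mulf_eq0 A_div) => /eqP.
  by rewrite subr_eq0 => /eqP; left.
by rewrite addr_eq0 => /eqP; right.
Qed.

Variables (gT : finGroupType) (rho : gT -> A).
Hypothesis rho_neq0 : forall x, rho x != 0.

Let rho_unit x : rho x \is a GRing.unit. Proof. exact: A_div. Qed.

(** Grouping a relation over [F] by classes modulo [X1] gives a relation over [L], so each group
    sums to zero. Such a sum is a polynomial in [x] of degree below [d], so its coefficients vanish;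
    each comes from a single term, because two elements of one class with the same power of [x]
    agree modulo [X]. *)
Lemma independent_mod_refine (F : fieldType) (L : fieldExtType F)
    (phi : {rmorphism F -> A}) (psi : {rmorphism L -> A}) (x : L) (d : nat)
    (P X1 : {group gT}) (X : {set gT}) :
    projective_over rho phi -> (forall c, psi c%:A = phi c) ->
    (forall g : {poly F}, (size g <= d)%N ->
       (map_poly (in_alg L) g).[x] = 0 -> g = 0) ->
    X1 \subset P ->
    {in X1, forall y, exists c, exists2 j, (j < d)%N & rho y = phi c * psi x ^+ j} ->
    {in P, forall y, (exists c, rho y = phi c) -> y \in X} ->
  independent_mod rho psi P X1 -> independent_mod rho phi P X.
Proof.
move=> rhoM psiA free sX1P X1E XE indL R a RP Rsep Ra0 y0 Ry0.
have Py y : y \in R -> y \in P by apply/subsetP.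
pose r y := repr (X1 :* y)%g.
have rX1 y : (r y \in X1 :* y)%g by apply: mem_repr (rcoset_refl _ _).
have rP y : y \in P -> r y \in P.
  by move=> Py'; have /rcosetP[t X1t ->] := rX1 y; rewrite groupM // (subsetP sX1P).
have rcE y : (X1 :* r y = X1 :* y)%g by apply/rcoset_eqP.
have [cj cjE] : exists cj : gT -> F * nat, forall y, y \in P ->
    [/\ (cj y).1 != 0, ((cj y).2 < d)%N
      & rho y = phi (cj y).1 * psi x ^+ (cj y).2 * rho (r y)].
  apply: (fin_all_exists (P := fun y cj => y \in P ->
    [/\ cj.1 != 0, (cj.2 < d)%N & rho y = phi cj.1 * psi x ^+ cj.2 * rho (r y)])) => y.
  have [Py'|] := boolP (y \in P); last by exists (0, 0%N).
  have X1yr : (y * (r y)^-1)%g \in X1 by rewrite -mem_rcoset rcE rcoset_refl.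
  have [c [j jd yrE]] := X1E _ X1yr.
  have [e e0] := projM A_div rho_neq0 rhoM (y * (r y)^-1)%g (r y).
  rewrite mulgKV yrE => yE; exists (e * c, j) => _; split=> //=.
    rewrite mulf_neq0 //; apply: contraNneq (rho_neq0 (y * (r y)^-1)%g) => c0.
    by rewrite yrE c0 rmorph0 mul0r.
  by rewrite [LHS]yE rmorphM !mulrA.
pose c y := (cj y).1; pose j y := (cj y).2.
pose b s : L := \sum_(y in R | r y == s) (a y * c y)%:A * x ^+ j y.
have r_y0 : r y0 \in [set r y | y in R] by apply: imset_f.
have br0 : {in [set r y | y in R], forall s, b s = 0}.
  apply: indL => [|_ _ /imsetP[y Ry ->] /imsetP[t Rt ->]|].
  - by apply/subsetP => _ /imsetP[y Ry ->]; rewrite rP ?Py.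
  - rewrite -mem_rcoset rcE => /rcoset_eqP; rewrite rcE => yt.
    by rewrite /r yt.
  rewrite -[RHS]Ra0 [RHS](partition_big r (mem [set r y | y in R])) /=; last first.
    by move=> y Ry; apply: imset_f.
  apply: eq_bigr => s _; rewrite rmorph_sum mulr_suml.
  apply: eq_bigr => y /andP[Ry /eqP ys].
  have [_ _ ->] := cjE y (Py y Ry); rewrite ys.
  by rewrite rmorphM rmorphXn psiA rmorphM !mulrA.
(* The value of this polynomial at [x] is [b (r y0)], which is zero, and its coefficient at [j y0]
   will turn out to be [a y0 * c y0]. *)
pose g : {poly F} := \sum_(y in R | r y == r y0) (a y * c y) *: 'X^(j y).
have g0 : g = 0.
  apply: free.
    apply: (leq_trans (size_sum _ _ _)); apply/bigmax_leqP => y /andP[Ry _].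
    apply: (leq_trans (size_scale_leq _ _)); rewrite size_polyXn.
    by have [] := cjE y (Py y Ry).
  rewrite -[RHS](br0 _ r_y0) rmorph_sum horner_sum; apply: eq_bigr => y _.
  by rewrite /= map_polyZ map_polyXn hornerZ hornerXn.
have /(congr1 (fun q : {poly F} => q`_(j y0))) := g0.
rewrite coef0 coef_sum (bigD1 y0) ?Ry0 ?eqxx //= big1 ?addr0 => [|y].
  rewrite coefZ coefXn eqxx mulr1 => /eqP; rewrite mulf_eq0.
  by have [/negPf cy0 _ _] := cjE y0 (Py _ Ry0); rewrite [c y0 == 0]cy0 orbF => /eqP.
move=> /andP[/andP[Ry /eqP ry] yy0]; rewrite coefZ coefXn.
have [jj|] := eqVneq (j y0) (j y); last by rewrite mulr0.
case/eqP: yy0; apply: Rsep => //; apply: XE; first by rewrite groupM ?groupV ?Py.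
have [c0 _ yE] := cjE y (Py y Ry); have [c00 _ y0E] := cjE y0 (Py _ Ry0).
have [e _ ->] := projMV A_div rho_neq0 rhoM y y0.
exists (e * (c y / c y0)); rewrite rmorphM; congr (_ * _).
apply: (mulIr (rho_unit y0)); rewrite divrK // yE y0E ry -/(j y) -/(j y0) jj.
by rewrite !mulrA -rmorphM divfK.
Qed.

(* For [p = 2] the obstruction is not [-1] but ['i], as [(1 + 'i) ^+ 2] is a *)
(* multiple of ['i]: this is the condition at [2] in Kneser's theorem. *)
Definition exotic (p : nat) (w : A) := w ^+ p = if p == 2%N then -1 else 1.

(* Adjoin to [F] a lift [u] of an element [z] of order [p] in the center of [P / X], *)
(* and apply the induction hypothesis over [F(u)] to the centraliser of [u]. *)
Lemma independent_mod_exotic (p : nat) (F : fieldType) (phi : {rmorphism F -> A})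
    (P X : {group gT}) : prime p ->
    (p.-group P)%g -> X \subset P -> p%:R != 0 :> F ->
    {in P, forall x c, phi c * rho x = rho x * phi c} ->
    projective_over rho phi ->
    {in P, forall x, x \in X <-> exists c, rho x = phi c} ->
    {in P, forall x c, exotic p (phi c * rho x) -> x \in X} ->
  independent_mod rho phi P X.
Proof.
(* The measure drops because the centraliser of [u] lies in [P], while the group of elements with a
   lift in the larger field contains [X] and also [z]. *)
move=> p_pr; have [m] := ubnP (#|P| - #|X|)%N.
elim: m F phi P X => // m IHm F phi P X /ltnSE-lem pP sXP pF phiP rhoM XE exoX.
have [sPX|nsPX] := boolP (P \subset X).
  move=> R a RP sep Ra x Rx; move: Ra.
  rewrite (bigD1 x) //= big1 ?addr0 => [|y /andP[Ry]].
    by rewrite -(mul0r (rho x)) => /(mulIr (rho_unit x))/eqP; rewrite fmorph_eq0 => /eqP.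
  case/eqP; apply: sep => //; apply: (subsetP sPX).
  by rewrite groupM ?groupV // (subsetP RP).
have nXP : (X <| P)%g.
  apply/andP; split=> //; apply/subsetP => y Py; rewrite inE.
  apply/subsetP => _ /imsetP[t Xt ->]; have Pt := subsetP sXP t Xt.
  apply/XE; first exact: groupJ.
  have [c tc] := (XE t Pt).1 Xt.
  have [d d0 E1] := projM A_div rho_neq0 rhoM y (t ^ y)%g.
  have [e e0 E2] := projM A_div rho_neq0 rhoM t y.
  exists (d^-1 * (e * c)); apply: (mulrI (rho_unit y)).
  apply: (mulrI (division_fmorph_unit A_div phi d0)).
  rewrite -E1 -conjgC E2 tc phiP // mulrA phiP // -mulrA -rmorphM.
  by rewrite mulrA phiP // -mulrA -rmorphM [d * _]mulrA divff // mul1r.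
have [z [Pz Xz Xzp Zz]] := central_mod_normal pP nXP nsPX.
pose u := rho z.
have u0 : u != 0 by apply: rho_neq0.
have phiu c : phi c * u = u * phi c by apply: phiP.
have uF c : u <> phi c by move=> uc; case/negP: Xz; apply/XE => //; exists c.
have [a up] : exists a, u ^+ p = phi a.
  have [c1 _ ->] := projX A_div rho_neq0 rhoM z p.
  have [|c2 ->] := (XE (z ^+ p)%g _).1 Xzp; first by rewrite groupX.
  by exists (c1 * c2); rewrite rmorphM.
have a0 : a != 0.
  by rewrite -(fmorph_eq0 phi) -up; apply: contraTneq (unitrX p (A_div u0)) => ->; rewrite unitr0.
have ucomm c : GRing.comm (phi c) u by apply: phiu.
have scaled_pow b : (phi b^-1 * u) ^+ p = phi (a / b ^+ p).
  by rewrite exprMn_comm // up -rmorphXn -rmorphM exprVn mulrC.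
have scaled_neq b c : b != 0 -> phi b^-1 * u <> phi c.
  move=> b0 ubc; apply: (uF (b * c)).
  by rewrite rmorphM -ubc mulrA -rmorphM divff // rmorph1 mul1r.
(* Were [a = b ^+ p], then [u / b] would be a [p]-th root of unity: exotic for odd [p], and [1] or
   [-1] for [p = 2], hence in [phi F]. *)
have a_pow b : b ^+ p != a.
  apply/eqP => bp; have b0 : b != 0.
    by apply: contraNneq a0 => b0; rewrite -bp b0 expr0n eqn0Ngt prime_gt0.
  have := scaled_pow b; rewrite bp divff // rmorph1.
  have [p2|p2] := eqVneq p 2%N; last first.
    by move=> w1; case/negP: Xz; apply: (exoX z Pz b^-1); rewrite /exotic (negPf p2).
  move=> wp; have w2 : (phi b^-1 * u) ^+ 2 = 1 ^+ 2 by rewrite expr1n -[X in _ ^+ X]p2.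
  have [w1|w1] := division_sqr_eq (commr1 _) w2.
    by apply: (scaled_neq b 1 b0); rewrite rmorph1.
  by apply: (scaled_neq b (-1) b0); rewrite rmorphN1.
(* Otherwise [u / b] would have square [-1] and be exotic. *)
have a_sqr : p = 2%N -> forall b, b ^+ 2 != - a.
  move=> p2 b; apply/eqP => bp; have b0 : b != 0.
    by apply: contraNneq a0 => b0; rewrite -oppr_eq0 -bp b0 expr0n.
  case/negP: Xz; apply: (exoX z Pz b^-1).
  by rewrite /exotic scaled_pow p2 bp invrN mulrN divff // rmorphN1.
have [|||L [psi [x [psix psiA gen free dimL]]]] :=
  @adjoin_root A A_div F phi u ('X^p - a%:P).
- by move=> c; rewrite /GRing.comm phiu.
- by rewrite -size_poly_gt0 size_XnsubC // prime_gt0.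
- by rewrite rmorphB /= map_polyXn map_polyC !hornerE hornerXn up subrr.
rewrite size_XnsubC ?prime_gt0 // ltnS in dimL.
have xp : x ^+ p = a%:A.
  by apply: (fmorph_inj psi); rewrite rmorphXn psix psiA up.
(* The degree is at most [p] by the choice of polynomial; if [p] did not divide it, taking the norm
   of [x ^+ p = a] would make [a] a [p]-th power. *)
have {}dimL : \dim {:L} = p.
  apply/eqP; rewrite eqn_leq dimL dvdn_leq ?adim_gt0 //.
  apply: contraT => pd; have co : coprime (\dim {:L}) p.
    by rewrite coprime_sym prime_coprime.
  have Nx : regnorm x ^+ p = a ^+ \dim {:L} by rewrite -regnormX xp regnormA.
  by have [b /eqP] := coprime_power_root a0 co Nx; rewrite (negPf (a_pow b)).
have phipsi c : exists d, phi c = psi d by exists c%:A; rewrite psiA.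
have rhoML : projective_over rho psi.
  by move=> y t; have [c yt] := rhoM y t; exists c%:A; rewrite psiA.
have genp y : exists2 g : {poly F}, (size g <= p)%N & y = (map_poly (in_alg L) g).[x].
  by have [g] := gen y; rewrite dimL => ?; exists g.
have [C [sCP CE]] := centraliser_subgroup A_div rho_neq0 rhoM P phiu.
have psiu l : psi l * u = u * psi l.
  by apply: (adjoin_commute (phi := phi) psiA (gen l)) => //; rewrite psix.
have psiC : {in C, forall y l, psi l * rho y = rho y * psi l}.
  move=> y Cy l; have Py := subsetP sCP y Cy.
  apply: (adjoin_commute (phi := phi) psiA (gen l)); first exact: phiP.
  by rewrite psix; apply/esym/eqP; rewrite -CE.
have [X1 [sX1C X1E]] := field_subgroup A_div rho_neq0 rhoML psiC.
have Cz : z \in C by rewrite CE.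
have X1z : z \in X1 by apply/X1E => //; exists x.
have psiM d j : psi (d%:A * x ^+ j) = phi d * u ^+ j.
  by rewrite rmorphM psiA rmorphXn psix.
(* Induction on the order of [y]: the lift of [y ^+ p] is a monomial in [u], so [l ^+ p] is a
   monomial in [x], and [radical_power_monomial] extracts the root. *)
have mono : {in C, forall y l, rho y = psi l -> exists d j, rho y = phi d * u ^+ j}.
  move=> y Cy; have /p_natP[e] : (p.-nat #[y])%g.
    by apply: mem_p_elt pP (subsetP sCP y Cy).
  move=> oy; have : (y ^+ (p ^ e) = 1)%g by rewrite -oy expg_order.
  elim: e {oy} y Cy => [|e IHe] y Cy yp l yl.
    have {yp}-> : y = 1%g by rewrite -(expg1 y).
    have [c ->] := proj_one A_div rho_neq0 rhoM.
    by exists c, 0%N; rewrite expr0 mulr1.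
  have [c c0 ypE] := projX A_div rho_neq0 rhoM y p.
  have ypl : rho (y ^+ p)%g = psi (c^-1%:A * l ^+ p).
    by rewrite rmorphM psiA rmorphXn -yl ypE mulrA -rmorphM mulVf // rmorph1 mul1r.
  have [||d [j ypd]] := IHe (y ^+ p)%g _ _ _ ypl.
  - by rewrite groupX.
  - by rewrite -expgM -expnS.
  have lp : l ^+ p = (c * d)%:A * x ^+ j.
    by apply: (fmorph_inj psi); rewrite psiM rmorphXn -yl ypE ypd mulrA rmorphM.
  have [d' [j' ld]] := radical_power_monomial p_pr dimL pF xp a_pow a_sqr (genp l) lp.
  by exists d', j'; rewrite yl ld psiM.
pose eps : F := if p == 2%N then -1 else 1.
have eps0 : eps != 0 by rewrite /eps; case: ifP; rewrite ?oppr_eq0 oner_eq0.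
have exoticE w : exotic p w -> w ^+ p = phi eps.
  by rewrite /exotic /eps => ->; case: ifP; rewrite ?rmorphN1 ?rmorph1.
have mulA_L (s t : F) : s%:A * t%:A = (s * t)%:A :> L.
  by rewrite -scalerAl mul1r scalerA.
(* If [psi l * rho y] is exotic, then [l ^+ p] is a monomial in [x], and so is [l], say with
   exponent [i]. Hence [u ^+ i * rho y] has an exotic multiple over [F], so [z ^+ i * y] lies in [X]
   and the lift of [y] lies in [psi L]. *)
have exoX1 : {in C, forall y l, exotic p (psi l * rho y) -> y \in X1}.
  move=> y Cy l exoly; have Py := subsetP sCP y Cy.
  have := exoticE _ exoly; rewrite exprMn_comm; last exact: psiC.
  rewrite -rmorphXn; have [c c0 ->] := projX A_div rho_neq0 rhoM y p => lyp.
  have l0 : l != 0.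
    apply: contraNneq eps0 => l0; rewrite -(fmorph_eq0 phi) -lyp l0.
    by rewrite expr0n eqn0Ngt prime_gt0 // rmorph0 mul0r.
  have lp0 : l ^+ p != 0 by rewrite expf_neq0.
  have Cyp : (y ^+ p)%g \in C by rewrite groupX.
  have ypl : rho (y ^+ p)%g = psi ((eps / c)%:A / l ^+ p).
    apply: (mulrI (division_fmorph_unit A_div phi c0)).
    apply: (mulrI (division_fmorph_unit A_div psi lp0)).
    rewrite lyp -!psiA -!rmorphM; congr (psi _).
    rewrite mulrCA [l ^+ p * _]mulrC divfK //.
    by rewrite -scalerAl mul1r scalerA mulrC divfK.
  have [d [j ypd]] := mono _ Cyp _ ypl.
  have d0 : d != 0.
    by apply: contraNneq (rho_neq0 (y ^+ p)%g) => d0; rewrite ypd d0 rmorph0 mul0r.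
  have x0 : x != 0 by rewrite -(fmorph_eq0 psi) psix.
  (* The exponent [p * j - j] stands for [- j], the factor [a ^+ j] in the denominator making up for
     [x ^+ (p * j)]. *)
  have lpE : l ^+ p = (eps / (c * d * a ^+ j))%:A * x ^+ (p * j - j).
    move: ypl; rewrite ypd -psiM => /(fmorph_inj psi) dj.
    have {}dj : l ^+ p * (d%:A * x ^+ j) = (eps / c)%:A by rewrite dj mulrC divfK.
    have xj0 : d%:A * x ^+ j != 0.
      by rewrite mulf_neq0 ?expf_neq0 // scaler_eq0 negb_or d0 oner_eq0.
    apply: (mulIf xj0); rewrite dj mulrACA -exprD subnK; last first.
      by rewrite leq_pmull // prime_gt0.
    rewrite exprM xp -[a%:A]/(in_alg L a) -rmorphXn /= !mulA_L.
    congr (_ *: _); have aj0 : a ^+ j != 0 by rewrite expf_neq0.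
    by field; rewrite aj0 d0 c0.
  have [d' [i ld]] := radical_power_monomial p_pr dimL pF xp a_pow a_sqr (genp l) lpE.
  have [e1 e10 E1] := projX A_div rho_neq0 rhoM z i.
  have [e2 e20 E2] := projM A_div rho_neq0 rhoM (z ^+ i)%g y.
  have uiy : u ^+ i * rho y = phi (e1 / e2) * rho (z ^+ i * y)%g.
    by rewrite E1 E2 !mulrA -rmorphM divfK.
  have Pziy : (z ^+ i * y)%g \in P by rewrite groupM ?groupX.
  have Xziy : (z ^+ i * y)%g \in X.
    apply: (exoX _ Pziy (d' * (e1 / e2))); rewrite rmorphM -mulrA -uiy.
    by rewrite mulrA -psiM -ld.
  have [e3 ziy] := (XE _ Pziy).1 Xziy.
  apply/X1E => //; exists ((e1 / e2 * e3)%:A / x ^+ i).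
  have Uui : u ^+ i \is a GRing.unit by rewrite unitrX // A_div.
  apply: (mulrI Uui); rewrite uiy ziy -rmorphM -psix -rmorphXn -rmorphM.
  by rewrite [x ^+ i * _]mulrC divfK ?expf_neq0 // psiA.
have XX1 : (X \proper X1)%g.
  apply/properP; split; last by exists z.
  apply/subsetP => y Xy; have Py := subsetP sXP y Xy.
  have [c yc] := (XE y Py).1 Xy.
  apply/X1E; first by rewrite CE // yc phiu.
  by exists c%:A; rewrite psiA.
have indC : independent_mod rho psi C X1.
  apply: (IHm L psi C X1 _ (pgroupS sCP pP) sX1C _ psiC rhoML X1E exoX1).
    apply: leq_trans lem; apply: (leq_ltn_trans (leq_sub2r _ (subset_leq_card sCP))).
    have XX1c := proper_card XX1; apply: ltn_sub2l => //.
    by apply: leq_trans XX1c _; rewrite subset_leq_card // (subset_trans sX1C).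
  by rewrite -(rmorph_nat (in_alg L)) fmorph_eq0.
have indP : independent_mod rho psi P X1.
  apply: (independent_mod_centraliser A_div rho_neq0 u0 rhoM phipsi phiP psiu _ _ indC).
    (* The commutator of [z] and [y] has its lift in [phi F], so conjugation by [u] multiplies
       [rho y] by an element of [phi F]. *)
    move=> y Py; have Xzy := Zz y Py.
    have [c zyc] := (XE _ (subsetP sXP _ Xzy)).1 Xzy.
    have [c1 c10 E1] := projM A_div rho_neq0 rhoM z y.
    have [c2 c20 E2] := projM A_div rho_neq0 rhoM (y * z)%g [~ z, y]%g.
    have [c3 c30 E3] := projM A_div rho_neq0 rhoM y z.
    exists (c1^-1 * (c2 * (c3 * c))); apply: (mulrI (division_fmorph_unit A_div phi c10)).
    rewrite -E1 commgC E2 E3 zyc -[phi c3 * _ * _]mulrA -[rho y * u * _]mulrA -phiu.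
    rewrite [rho y * _]mulrA -phiP // !mulrA -!rmorphM; congr (phi _ * _ * _).
    by field.
  by move=> y Py yu; rewrite CE // yu.
apply: (independent_mod_refine rhoM psiA (x := x) (d := p) _ _ _ _ indP).
- by move=> g szg; apply: free; rewrite dimL.
- exact: subset_trans sX1C sCP.
- move=> y X1y; have Cy := subsetP sX1C y X1y.
  have [l yl] := (X1E y Cy).1 X1y; have [c [j ->]] := mono y Cy l yl.
  exists (c * a ^+ (j %/ p)), (j %% p)%N; first by rewrite ltn_mod prime_gt0.
  by rewrite psix {1}(divn_eq j p) exprD mulnC exprM up rmorphM rmorphXn mulrA.
- by move=> y Py yc; apply/XE.
Qed.
End NoncommutativeKneser.

(** * The bound on Sylow subgroups *)

Section DimensionCount.

Local Open Scope ring_scope.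

Variables (k : fieldType) (A : falgType k).
Hypothesis A_div : forall x : A, x != 0 -> x \is a GRing.unit.
Variables (gT : finGroupType) (rho : gT -> A).
Hypothesis rho_neq0 : forall x, rho x != 0.
Hypothesis rhoM : projective_over rho (in_alg A).

(** The span [W] of the spaces [psi L * rho y], for [y] in [P], is closed under products, so it is a
    division subalgebra and its dimension divides that of [A]. By independence it is the direct sum
    over one representative [y] of each class modulo [X]. *)
Lemma dim_projective_span (L : fieldExtType k) (psi : {rmorphism L -> A})
    (P X : {group gT}) :
    (forall c, psi c%:A = c%:A) -> X \subset P ->
    {in P, forall y l, exists l', rho y * psi l = psi l' * rho y} ->
    {in X, forall y, exists l, rho y = psi l} ->
    independent_mod rho psi P X ->
  (#|P| * \dim {:L} %| \dim {:A} * #|X|)%N.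
Proof.
move=> psiA sXP Ppsi Xpsi indP.
have psiZ c l : psi (c *: l) = c *: psi l.
  by rewrite -[l in LHS]mul1r scalerAl rmorphM psiA -scalerAl mul1r.
pose f y l := psi l * rho y.
have f_lin y : linear (f y).
  by move=> c l l'; rewrite /f rmorphD psiZ mulrDl scalerAl.
pose fL y : {linear L -> A} := HB.pack (f y)
  (GRing.isLinear.Build k L A *:%R (f y) (f_lin y)).
pose V y := limg (linfun (fL y)).
have memV y v : reflect (exists l, v = psi l * rho y) (v \in V y).
  apply: (iffP memv_imgP) => [[l _ ->]|[l ->]]; exists l; rewrite ?memvf ?lfunE //.
have dimV y : \dim (V y) = \dim {:L}.
  apply: limg_dim_eq; apply/eqP; rewrite -subv0; apply/subvP => l.
  rewrite memv_cap memvf memv_ker lfunE /= /f memv0 => /eqP l0.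
  by rewrite -(fmorph_eq0 psi) -(inj_eq (mulIr (A_div (rho_neq0 y)))) l0 mul0r.
pose R := [set repr Y | Y in rcosets X P].
have rP y : y \in P -> repr (X :* y)%g \in P.
  move=> Py; have /rcosetP[t Xt ->] := mem_repr _ (rcoset_refl X y).
  by rewrite groupM // (subsetP sXP).
have rcE y : (X :* repr (X :* y) = X :* y)%g.
  by apply/rcoset_eqP/mem_repr/rcoset_refl.
have sRP : R \subset P.
  by apply/subsetP => _ /imsetP[Y /rcosetsP[y Py ->] ->]; apply: rP.
have Rsep : {in R &, forall y t, (y * t^-1)%g \in X -> y = t}.
  move=> _ _ /imsetP[_ /rcosetsP[y Py ->] ->] /imsetP[_ /rcosetsP[t Pt ->] ->].
  by rewrite -mem_rcoset rcE => /rcoset_eqP; rewrite rcE => ->.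
have cardR : (#|R| * #|X|)%N = #|P|.
  rewrite card_in_imset -?[#|rcosets _ _|]/(#|P : X|%g) 1?mulnC ?Lagrange //.
  move=> _ _ /rcosetsP[y Py ->] /rcosetsP[t Pt ->] yt.
  by rewrite -rcE yt rcE.
pose W := (\sum_(y in R) V y)%VS.
have VW y : y \in P -> (V y <= W)%VS.
  move=> Py; pose r := repr (X :* y)%g.
  have Rr : r \in R by apply/imsetP; exists (X :* y)%g; rewrite // mem_rcosets mulSGid.
  apply: subv_trans (sumv_sup r Rr (subvv _)).
  have Xyr : (y * r^-1)%g \in X by rewrite -mem_rcoset rcE rcoset_refl.
  have [l yrl] := Xpsi _ Xyr.
  have [c _ ] := projM A_div rho_neq0 rhoM (y * r^-1)%g r.
  rewrite mulgKV yrl => yE; apply/subvP => _ /memV[l' ->]; apply/memV.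
  by exists (l' * (c%:A * l)); rewrite yE !rmorphM psiA !mulrA.
have W1 : 1 \in W.
  apply: (subvP (VW 1%g (group1 P))); apply/memV.
  have [c r1] := proj_one A_div rho_neq0 rhoM; exists (c^-1)%:A.
  have c0 : c != 0 by rewrite -(fmorph_eq0 (in_alg A)) -r1.
  by rewrite psiA r1 -[_%:A]/(in_alg A _) -rmorphM mulVf ?rmorph1.
have WW : (W * W <= W)%VS.
  apply/prodvP => _ _ /memv_sumP[v Vv ->] /memv_sumP[w Vw ->].
  rewrite mulr_suml rpred_sum // => y Ry; rewrite mulr_sumr rpred_sum // => t Rt.
  have [/memV[l ->] /memV[l' ->]] := (Vv y Ry, Vw t Rt).
  have [Py Pt] := (subsetP sRP y Ry, subsetP sRP t Rt).
  apply: (subvP (VW _ (groupM Py Pt))); apply/memV.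
  have [l2 l2E] := Ppsi y Py l'; have [c c0 ->] := projM A_div rho_neq0 rhoM y t.
  exists (l * l2 * (c^-1)%:A); rewrite !rmorphM psiA /=.
  rewrite -!mulrA [rho y * (_ * _)]mulrA l2E -!mulrA; do 2!congr (_ * _).
  by rewrite -!scalerAl !mul1r scalerA mulVf // scale1r.
pose WA := ASpace (introT andP (conj (has_algid1 W1) WW) : is_aspace W).
have dimW : \dim WA = (#|R| * \dim {:L})%N.
  have /directvP /= -> : directv (\sum_(y in R) V y).
    apply/directv_sum_independent => v Vv v0 y Ry.
    have [a aE] : exists a : gT -> L, forall y, y \in R -> v y = psi (a y) * rho y.
      apply: (fin_all_exists (P := fun y l => y \in R -> v y = psi l * rho y)) => t.
      by have [/Vv/memV[l]|] := boolP (t \in R); [exists l | exists 0].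
    rewrite aE // (indP R a sRP Rsep) ?rmorph0 ?mul0r // -[RHS]v0.
    by apply: eq_bigr => t Rt; rewrite aE.
  by rewrite (eq_bigr (fun=> \dim {:L})) // sum_nat_const.
rewrite -cardR mulnAC dvdn_pmul2r // -dimW.
by apply: (@skew_field_dimS k A _ WA {:A}%AS) (subvf _) => x /A_div.
Qed.

End DimensionCount.

(** * Exotic elements and torsion in a Sylow subgroup *)

Section SylowPart.

Local Open Scope ring_scope.

(** For odd [p], [b] is a primitive [p]-th root of unity, so [X^p - 1] splits over [F] and one of
    its linear factors kills [v]. For [p = 2], [v] and [phi b] commute and have the same square. *)
Lemma exotic_in_field (A : unitRingType) (F : fieldType)
    (phi : {rmorphism F -> A}) (p : nat) (b : F) (v : A) :
    (forall x : A, x != 0 -> x \is a GRing.unit) -> prime p ->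
    exotic p (phi b) -> (p != 2%N -> b != 1) ->
    (forall c, phi c * v = v * phi c) -> exotic p v ->
  exists c, v = phi c.
Proof.
move=> A_div p_pr; rewrite /exotic => bp b1 phiv vp.
have [p2|p2] := eqVneq p 2%N.
  rewrite {p_pr b1}p2 eqxx -rmorphXn in bp vp.
  have v2 : v ^+ 2 = phi b ^+ 2 by rewrite -rmorphXn bp.
  have [->|->] := division_sqr_eq A_div (esym (phiv b)) v2; first by exists b.
  by exists (- b); rewrite rmorphN.
rewrite (negPf p2) in bp vp.
have {}bp : b ^+ p = 1 by apply: (fmorph_inj phi); rewrite rmorphXn bp rmorph1.
have b_prim : p.-primitive_root b.
  have [m mb mp] := prim_order_exists (prime_gt0 p_pr) bp.
  have /primeP[_ /(_ m mp)/orP[/eqP m1|/eqP<- //]] := p_pr.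
  by move: (prim_expr_order mb) (b1 p2); rewrite m1 expr1 => ->; rewrite eqxx.
have cfv : commr_rmorph phi v by move=> c; apply/esym/phiv.
have := congr1 (horner_morph cfv) (factor_Xn_sub_1 b_prim).
rewrite rmorphB rmorphXn rmorph1 /= horner_morphX vp subrr rmorph_prod /= => prod0.
apply: contrapT => nv; move/eqP: prod0; apply/negP.
apply: contraTneq (unitr1 A) => prod0.
have : \prod_(0 <= i < p) horner_morph cfv ('X - (b ^+ i)%:P) \is a GRing.unit.
  apply: rpred_prod => i _; apply: A_div.
  rewrite rmorphB /= horner_morphX horner_morphC subr_eq0.
  by apply/eqP => vE; apply: nv; exists (b ^+ i).
by rewrite prod0 unitr0.
Qed.

Variables (k : fieldType) (A : falgType k).
Hypothesis A_div : forall x : A, x != 0 -> x \is a GRing.unit.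
Variables (gT : finGroupType) (rho : gT -> A).
Hypothesis rho_neq0 : forall x, rho x != 0.
Hypothesis rhoM : projective_over rho (in_alg A).
Hypothesis rho_faithful : forall x c, rho x = c%:A -> x = 1%g.

(** The hypothesis leaves in [k] no [p]-th root of unity but [1] for odd [p], and no square root of
    [-1] for [p = 2]. Factors [p] can thus be removed from [j], up to a sign when [p = 2], and a
    root of unity of order prime to [p] is a [p]-th power. *)
Lemma torsion_power_root (p j : nat) (e : k) :
    prime p -> (forall b : k, b ^+ p = (if p == 2%N then -1 else 1) -> p != 2%N /\ b = 1) ->
    (0 < j)%N -> e ^+ j = 1 ->
  exists b, e = b ^+ p \/ p = 2%N /\ e = - b ^+ p.
Proof.
move=> p_pr no_exo; have [m] := ubnP j.
elim: m j => // m IHm j /ltnSE-lejm j0 ej.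
have coprime_case (i : nat) (f : k) :
    ~~ (p %| i)%N -> (0 < i)%N -> f ^+ i = 1 -> exists b, f = b ^+ p.
  move=> pi i0 fi; have f0 : f != 0.
    by apply: contraTneq isT => f0; move/eqP: fi; rewrite f0 expr0n gtn_eqF // eq_sym oner_eq0.
  have co : coprime i p by rewrite coprime_sym prime_coprime.
  have fp : 1 ^+ p = f ^+ i by rewrite expr1n.
  by have [b <-] := coprime_power_root f0 co fp; exists b.
have [/dvdnP[l jl]|pj] := boolP (p %| j)%N; last first.
  by have [b eb] := coprime_case _ _ pj j0 ej; exists b; left.
have l0 : (0 < l)%N by move: j0; rewrite jl; case: (l).
have ltlj : (l < j)%N by rewrite jl ltn_Pmulr // prime_gt1.
have ltlm := leq_trans ltlj lejm.
have elp : (e ^+ l) ^+ p = 1 by rewrite -exprM -jl.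
have [p2|p2] := eqVneq p 2%N; last first.
  have [|_ el] := no_exo (e ^+ l); first by rewrite (negPf p2).
  exact: IHm l ltlm l0 el.
have : (e ^+ l - 1) * (e ^+ l + 1) = 0 by rewrite -subr_sqr_1 -[X in _ ^+ X]p2 elp subrr.
move/eqP; rewrite mulf_eq0 subr_eq0 addr_eq0 => /orP[/eqP el|/eqP el].
  exact: IHm l ltlm l0 el.
(* Here [e ^+ l = -1]: an even [l] would give a square root of [-1], and for odd [l] it is [- e]
   that has odd order. *)
have [/dvdnP[i li]|pl] := boolP (p %| l)%N.
  have [|] := no_exo (e ^+ i); first by rewrite -exprM -li el p2.
  by rewrite p2.
have odd_l : odd l by move: pl; rewrite p2 dvdn2 negbK.
have [b eb] : exists b, - e = b ^+ p.
  by apply: (coprime_case l) => //; rewrite exprNn -signr_odd odd_l el mulrNN mulr1.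
by exists b; right; rewrite -eb opprK.
Qed.

(** The class of [x0] is torsion, so [P :&: N] is a nontrivial normal subgroup of [P] and contains a
    central [z] of order [p]. A torsion lift of [z] has as [p]-th power a root of unity of [k], and
    [torsion_power_root] allows rescaling it to an exotic lift. *)
Lemma exists_central_exotic (p : nat) (P N : {group gT}) (x0 : gT) (c0 : k) :
    prime p -> p%:R != 0 :> k -> (p.-group P)%g -> P \subset 'N(N)%g ->
    (forall x, x \in N <-> exists c j, [/\ c != 0, (0 < j)%N & (c *: rho x) ^+ j = 1]) ->
    x0 \in P -> x0 != 1%g -> exotic p (c0 *: rho x0) ->
  exists z c, [/\ z \in P, z \in 'Z(P)%g, #[z]%g = p, c != 0 & exotic p (c *: rho z)].
Proof.
move=> p_pr pF pP nNP NE Px0 x01 exo0.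
have c00 : c0 != 0.
  apply: contra_eqN exo0 => /eqP->; rewrite scale0r expr0n eqn0Ngt prime_gt0 //=.
  by case: ifP => _; rewrite eq_sym ?oppr_eq0 oner_eq0.
have rho_scale x c d : c != 0 -> x != 1%g -> c *: rho x <> d%:A.
  move=> c_0 x1 xcd; case/eqP: x1; apply: (rho_faithful (c := c^-1 * d)).
  by rewrite -scalerA -xcd scalerA mulVf // scale1r.
(* By [exotic_in_field], such an element of [k] would force the exotic lift of [x0] to be a
   scalar. *)
have no_exo (b : k) : b ^+ p = (if p == 2%N then -1 else 1) -> p != 2%N /\ b = 1.
  move=> bp; apply: contrapT => nb.
  have exob : exotic p (in_alg A b).
    by rewrite /exotic -rmorphXn bp; case: ifP; rewrite ?rmorphN1 ?rmorph1.
  have b1 : p != 2%N -> b != 1 by move=> p2; apply/eqP => b1; apply: nb.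
  have [|c] := exotic_in_field A_div p_pr exob b1 _ exo0.
    by move=> c; rewrite /= -scalerAl mul1r -scalerAr mulr1.
  exact: rho_scale.
have Nx0 : x0 \in N.
  apply/NE; exists c0, (p * 2)%N; rewrite muln_gt0 prime_gt0 //; split=> //.
  by rewrite exprM exo0; case: ifP; rewrite ?sqrrN expr1n.
have ntPN : (P :&: N != 1)%g by apply/trivgPn; exists x0; rewrite // inE Px0.
have nPN : (P :&: N <| P)%g by rewrite /normal subsetIl normsI ?normG.
have ntZ := meet_center_nil (pgroup_nil pP) nPN ntPN.
have pZ : (p.-group (P :&: N :&: 'Z(P)))%g.
  by apply: pgroupS pP; rewrite (subset_trans (subsetIl _ _)) ?subsetIl.
have [_ pdZ _] := pgroup_pdiv pZ ntZ.
have [z /setIP[/setIP[Pz Nz] Zz] oz] := Cauchy p_pr pdZ.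
have z1 : z != 1%g by rewrite -order_gt1 oz prime_gt1.
have [c [j [c_0 j0 wj]]] := (NE z).1 Nz.
set w := c *: rho z in wj.
have [e wp] : exists e, w ^+ p = e%:A.
  have [d _ zp] := projX A_div rho_neq0 rhoM z p.
  have [d1 r1] := proj_one A_div rho_neq0 rhoM.
  have zp1 : (z ^+ p = 1)%g by rewrite -oz expg_order.
  exists (c ^+ p * (d * d1)); rewrite exprZn zp zp1 r1 /=.
  by rewrite -scalerAl mul1r !scalerA mulrA.
have ej : e ^+ j = 1.
  apply: (fmorph_inj (in_alg A)); rewrite rmorphXn rmorph1 /= -wp.
  by rewrite exprAC wj expr1n.
have [b eb] := torsion_power_root p_pr no_exo j0 ej.
have b0 : b != 0.
  apply: contraTneq isT => b0; move/eqP: ej.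
  case: eb => [->|[_ ->]]; rewrite b0 expr0n (gtn_eqF (prime_gt0 p_pr)) ?oppr0 expr0n gtn_eqF //;
    by rewrite eq_sym oner_eq0.
have wE : b^-1 *: w = (b^-1 * c) *: rho z by rewrite scalerA.
have cb0 : b^-1 * c != 0 by rewrite mulf_neq0 ?invr_eq0.
exists z, (b^-1 * c); split=> //; rewrite -wE /exotic exprZn wp scalerA exprVn.
case: eb => [eb|[p2 ->]]; last by rewrite p2 eqxx mulrN mulVf ?expf_neq0 // scaleN1r.
rewrite eb mulVf ?expf_neq0 // scale1r; case: eqP => // p2.
(* For [p = 2] this case is impossible: a lift of square [1] is [1] or [-1], against [z != 1]. *)
have w2 : (b^-1 *: w) ^+ 2 = 1 ^+ 2.
  rewrite -[X in _ ^+ X]p2 exprZn wp scalerA exprVn eb.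
  by rewrite mulVf ?expf_neq0 // scale1r expr1n.
have [w1|w1] := division_sqr_eq A_div (commr1 _) w2.
  by case: (rho_scale z (b^-1 * c) 1 cb0 z1); rewrite -wE w1 scale1r.
by case: (rho_scale z (b^-1 * c) (-1) cb0 z1); rewrite -wE w1 scaleN1r.
Qed.

(** Without exotic lifts, independence over [k] shows that [#|P|] divides [\dim {:A}]. Otherwise let
    [u] be a central exotic lift, [d] the degree of [L = k(u)] and [X] the group of elements with a
    lift in [L]: then [#|P| * d] divides [\dim {:A} * #|X|], and it suffices to compare [#|X|] with
    [d * #|P :&: N|]. *)
Lemma pgroup_dvd_dim_torsion (p : nat) (P N : {group gT}) :
    prime p -> p%:R != 0 :> k -> (p.-group P)%g -> P \subset 'N(N)%g ->
    (forall x, x \in N <-> exists c j, [/\ c != 0, (0 < j)%N & (c *: rho x) ^+ j = 1]) ->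
  (#|P| %| \dim {:A} * #|(P :&: N)%g|)%N.
Proof.
move=> p_pr pF pP nNP NE.
have [[x0 [c0 [Px0 x01 exo0]]]|no_exo] := pselect (exists x0 c0,
  [/\ x0 \in P, x0 != 1%g & exotic p (c0 *: rho x0)]); last first.
  pose psi : {rmorphism k^o -> A} := in_alg A.
  have psiC y (l : k^o) : psi l * rho y = rho y * psi l.
    by rewrite /= -scalerAl -scalerAr mul1r mulr1.
  have ind : independent_mod rho psi P 1%G.
    apply: (independent_mod_exotic A_div rho_neq0 p_pr pP (sub1G P) pF _ rhoM).
    - by move=> y _ c; apply: psiC.
    - move=> y _; split=> [/set1gP->|[c yc]].
        by have [c ->] := proj_one A_div rho_neq0 rhoM; exists c.
      by apply/set1gP/(rho_faithful (c := c)).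
    - move=> y Py c exo; apply/set1gP; apply: contrapT => /eqP y1; apply: no_exo.
      by exists y, c; split=> //; move: exo; rewrite /= -scalerAl mul1r.
  have := dim_projective_span A_div rho_neq0 rhoM _ (sub1G P) _ _ ind.
  rewrite cards1 muln1 dimvf /= muln1 => dvd; apply: dvdn_mulr; apply: dvd.
  - by move=> c; rewrite /= [c *: _]mulr1.
  - by move=> y Py l; exists l; rewrite psiC.
  - by move=> y /set1gP->; have [c ->] := proj_one A_div rho_neq0 rhoM; exists c.
have [z [c1 [Pz Zz oz c10 exo]]] := exists_central_exotic p_pr pF pP nNP NE Px0 x01 exo0.
have z1 : z != 1%g by rewrite -order_gt1 oz prime_gt1.
set u := c1 *: rho z in exo.
have uF c : u <> c%:A.
  move=> uc; case/eqP: z1; apply: (rho_faithful (c := c1^-1 * c)).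
  by rewrite -scalerA -uc scalerA mulVf // scale1r.
have u0 : u != 0 by apply/eqP => u0; apply: (uF 0); rewrite scale0r.
have uP : {in P, forall y, exists2 c, c != 0 & u * rho y = c%:A * rho y * u}.
  move=> y Py; have /centerP[_ cz] := Zz.
  have [c c_0 zy] := projC A_div rho_neq0 rhoM (cz y Py).
  by exists c; rewrite // -scalerAl zy -scalerAr /= !mulrA.
have [c2 uz] : exists c, u = c%:A * rho z by exists c1; rewrite -scalerAl mul1r.
clearbody u.
have phiC (w : A) (c : k) : in_alg A c * w = w * in_alg A c.
  by rewrite /= -scalerAl -scalerAr mul1r mulr1.
(* For [p = 2] take [X^2 + 1], otherwise [1 + X + ... + X^(p-1)]. With [d != 1], the bound on the
   size will give [d = 2] in the first case and [d < p] in the second. *)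
have [f [f0 fu szf]] : exists f : {poly k},
    [/\ f != 0, (map_poly (in_alg A) f).[u] = 0 & (size f <= maxn p 3)%N].
  have [p2|p2] := eqVneq p 2%N.
    exists ('X^2 + 1%:P); split; last by rewrite size_XnaddC // leq_maxr.
      by rewrite -size_poly_gt0 size_XnaddC.
    rewrite rmorphD /= map_polyXn map_polyC /= scale1r !hornerE hornerXn.
    by move: exo; rewrite /exotic p2 => ->; rewrite addNr.
  exists (\sum_(i < p) 'X^i); split.
  - apply/eqP => /(congr1 (fun q : {poly k} => q`_0)); rewrite coef0 coef_sum.
    rewrite (bigD1 (Ordinal (prime_gt0 p_pr))) //= coefXn eqxx big1 ?addr0.
      by move/eqP; rewrite oner_eq0.
    by move=> i; rewrite -val_eqE coefXn eq_sym /= => /negPf->.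
  - have : (u - 1) * (map_poly (in_alg A) (\sum_(i < p) 'X^i)).[u] = 0.
      rewrite rmorph_sum horner_sum mulr_sumr.
      have := subrX1 u p; rewrite exo (negPf p2) subrr mulr_sumr => sum0; rewrite [RHS]sum0.
      by apply: eq_bigr => i _; rewrite /= map_polyXn hornerXn.
    move=> /(division_mulf_eq0 A_div)[/eqP|//]; rewrite subr_eq0 => /eqP u1.
    by case: (uF 1); rewrite scale1r.
  - apply: (leq_trans (size_sum _ _ _)); apply/bigmax_leqP => i _.
    by rewrite size_polyXn leq_max ltn_ord.
have [L [psi [x [psix psiA gen free dimL]]]] :=
  @adjoin_root A A_div k (in_alg A) u f (fun c => esym (phiC u c)) f0 fu.
set d := \dim {:L} in gen free dimL.
have d_gt0 : (0 < d)%N by apply: adim_gt0.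
have x1 : x != 1.
  by apply/eqP => x1; apply: (uF 1); rewrite -psix x1 rmorph1 scale1r.
have d_neq1 : d != 1%N.
  apply/eqP => d1; have xF : x \in 1%VS.
    suff <- : {:L}%VS = 1%VS by rewrite memvf.
    by apply/esym/eqP; rewrite eqEdim sub1v dimv1 -/d d1.
  have /vlineP[c xc] := xF; apply: (uF c).
  by rewrite -psix xc psiA.
have exox : exotic p (psi x) by rewrite psix.
have rhoML : projective_over rho psi.
  by move=> y t; have [c yt] := rhoM y t; exists c%:A; rewrite psiA.
have [C [sCP CE]] := centraliser_subgroup A_div rho_neq0 rhoM P (phiC u).
have psiu l : psi l * u = u * psi l.
  by apply: (adjoin_commute psiA (gen l) (phiC u)); rewrite psix.
have psiC : {in C, forall y l, psi l * rho y = rho y * psi l}.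
  move=> y Cy l; apply: (adjoin_commute psiA (gen l) (phiC _)).
  by rewrite psix; apply/esym/eqP; rewrite -CE // (subsetP sCP).
have [X [sXC XE]] := field_subgroup A_div rho_neq0 rhoML psiC.
have sXP := subset_trans sXC sCP.
(* Since [L] contains the exotic element [x != 1], an exotic element commuting with [psi L] lies in
   [psi L]. *)
have exoX : {in C, forall y l, exotic p (psi l * rho y) -> y \in X}.
  move=> y Cy l exoly; have [|l' l'E] := exotic_in_field A_div p_pr exox (fun=> x1) _ exoly.
    by move=> l'; rewrite mulrA -rmorphM mulrC rmorphM -!mulrA psiC // mulrA.
  apply/XE => //; exists (l^-1 * l'); rewrite rmorphM -l'E mulrA -rmorphM mulVf ?rmorph1 ?mul1r //.
  apply: contra_eqN exoly => /eqP->; rewrite rmorph0 mul0r expr0n eqn0Ngt prime_gt0 //=.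
  by case: ifP => _; rewrite eq_sym ?oppr_eq0 oner_eq0.
have pL : p%:R != 0 :> L by rewrite -(rmorph_nat (in_alg L)) fmorph_eq0.
have indC : independent_mod rho psi C X.
  exact: (independent_mod_exotic A_div rho_neq0 p_pr (pgroupS sCP pP) sXC pL psiC rhoML XE exoX).
have indP : independent_mod rho psi P X.
  apply: (independent_mod_centraliser A_div rho_neq0 u0 rhoM _ _ psiu _ _ indC).
  - by move=> c; exists c%:A; rewrite psiA.
  - by move=> y _ c; apply: phiC.
  - by move=> y /uP[c _ ->]; exists c.
  - by move=> y Py yu; rewrite CE // yu.
have dvd_dim : (#|P| * d %| \dim {:A} * #|X|)%N.
  apply: (dim_projective_span A_div rho_neq0 rhoM psiA sXP _ _ indP).
    move=> y Py l; have [g _ ->] := gen l; have [c c_0 uy] := uP y Py.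
    (* Conjugation by [rho y] takes [u] to [c^-1 * u], hence [g(u)] to [g(c^-1 * u)]. *)
    exists (\sum_(i < size g) (g`_i * c^-1 ^+ i)%:A * x ^+ i).
    have yu : rho y * u = (c^-1)%:A * (u * rho y).
      by rewrite uy -!scalerAl !mul1r scalerA mulVf // scale1r.
    have yui i : rho y * u ^+ i = (c^-1 ^+ i)%:A * u ^+ i * rho y.
      elim: i => [|i IH]; first by rewrite !expr0 scale1r !mul1r mulr1.
      rewrite [u ^+ i.+1]exprS [LHS]mulrA yu -[LHS]mulrA -[u * _ * _]mulrA IH.
      rewrite -!scalerAl !mul1r -!scalerAr scalerA -[c^-1 * _]exprS.
      by rewrite !mulrA.
    rewrite -horner_map -map_poly_comp horner_coef size_map_poly.
    rewrite mulr_sumr rmorph_sum mulr_suml; apply: eq_bigr => i _.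
    rewrite coef_map rmorphM rmorphXn psix psiA /= psiA /=.
    by rewrite -scalerAl mul1r -scalerAr yui -!scalerAl !mul1r scalerA.
  by move=> y Xy; apply/XE => //; apply: (subsetP sXC).
(* [l ^+ d] and the norm of [l] differ by a root of unity; [d] is prime to [p], *)
(* or [d = p = 2] and squaring on [X] has kernel at most [<[z]>]. *)
suff dvd_X : (#|X| %| d * #|(P :&: N)%g|)%N.
  rewrite -(dvdn_pmul2r d_gt0) (dvdn_trans dvd_dim) // -mulnA [(_ * d)%N]mulnC.
  by rewrite dvdn_mul.
have powN : {in X, forall y, (y ^+ d)%g \in P :&: N}.
  move=> y Xy; have Py := subsetP sXP y Xy.
  have [l yl] := (XE y (subsetP sXC y Xy)).1 Xy.
  rewrite inE groupX //=.
  have l0 : l != 0 by rewrite -(fmorph_eq0 psi) -yl rho_neq0.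
  pose q := #|P|; have yq : (y ^+ q = 1)%g by apply: expg_cardG.
  have [e yqe] : exists e, rho y ^+ q = e%:A.
    have [c _ ->] := projX A_div rho_neq0 rhoM y q.
    have [c' ye] := proj_one A_div rho_neq0 rhoM; exists (c * c').
    by rewrite yq ye /= -scalerAl mul1r scalerA.
  have lq : l ^+ q = e%:A by apply: (fmorph_inj psi); rewrite rmorphXn -yl yqe psiA.
  have Nl0 : regnorm l != 0 by apply: regnorm_neq0; rewrite unitfE.
  have Nlq : regnorm l ^+ q = e ^+ d by rewrite -regnormX lq regnormA.
  have [c c_0 yd] := projX A_div rho_neq0 rhoM y d.
  apply/NE; exists ((regnorm l)^-1 * c), q; split.
  - by rewrite mulf_neq0 ?invr_eq0.
  - exact: cardG_gt0.
  have -> : (regnorm l)^-1 * c *: rho (y ^+ d)%g = (regnorm l)^-1 *: rho y ^+ d.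
    by rewrite yd /= -scalerAl mul1r scalerA.
  rewrite exprZn exprAC yqe -[e%:A]/(in_alg A e) -rmorphXn /= scalerA exprVn -Nlq.
  by rewrite mulVf ?scale1r // expf_neq0.
have [p2|p2] := eqVneq p 2%N; last first.
  have ltdp : (d < p)%N.
    have := leq_trans dimL szf; rewrite (maxn_idPl _) //.
    by have := prime_gt1 p_pr; case: (p) p2 => [|[|[|]]].
  apply: dvdn_mull; apply: cardSg; apply/subsetP => y Xy.
  have co : coprime #[y]%g d.
    apply: (@pnat_coprime p); first exact: mem_p_elt pP (subsetP sXP y Xy).
    by rewrite p'natE // gtnNdvd.
  have := co; rewrite -generator_coprime => /eqP yd.
  have : y \in <[y ^+ d]>%g by rewrite -yd cycle_id.
  by apply/subsetP; rewrite cycle_subG powN.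
have d2 : d = 2%N.
  apply/eqP; rewrite eqn_leq; apply/andP; split; last by case: (d) d_gt0 d_neq1 => [|[|]].
  by have := leq_trans dimL szf; rewrite p2.
(* The lifts commute, being in [psi L], so [y * t] and [t * y] have lifts proportional over [k] and
   coincide by faithfulness. *)
have abX : abelian X.
  apply/centsP => y Xy t Xt.
  have [l yl] := (XE y (subsetP sXC y Xy)).1 Xy.
  have [l' tl] := (XE t (subsetP sXC t Xt)).1 Xt.
  have [c c_0 E1] := projM A_div rho_neq0 rhoM y t.
  have [c' c'_0 E2] := projM A_div rho_neq0 rhoM t y.
  have [e _ E3] := projMV A_div rho_neq0 rhoM (y * t)%g (t * y)%g.
  have yt1 : (y * t * (t * y)^-1 = 1)%g.
    apply: (rho_faithful (c := e * (c / c'))).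
    have yt : rho (y * t)%g = (c / c')%:A * rho (t * y)%g.
      rewrite E1 E2 yl tl -!rmorphM [l' * l]mulrC /= -!scalerAl !mul1r scalerA.
      by rewrite divfK.
    by rewrite E3 yt mulrK ?A_div // /= -scalerAl mul1r scalerA.
  by move/eqP: yt1; rewrite mulg_eq1 invgK => /eqP.
have x2 : x ^+ 2 = -1.
  by apply: (fmorph_inj psi); rewrite rmorphXn rmorphN1; move: exox; rewrite /exotic p2.
have two0 : 2%:R != 0 :> k by move: pF; rewrite p2.
(* Write [l = g0 + g1 * x] with [x ^+ 2 = -1]. As [l ^+ 2] is in [k], [2 * g0 * g1 = 0]: either [l]
   is a scalar and [y = 1], or [l] is a multiple of [x] and [y = z]. *)
have sqr1 : {in X, forall y, (y ^+ 2 = 1)%g -> y \in <[z]>%g}.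
  move=> y Xy y2; have [l yl] := (XE y (subsetP sXC y Xy)).1 Xy.
  have [e le] : exists e, l ^+ 2 = e%:A.
    have [c _ ye] := projX A_div rho_neq0 rhoM y 2.
    have [c' re] := proj_one A_div rho_neq0 rhoM; exists (c * c').
    apply: (fmorph_inj psi); rewrite rmorphXn -yl ye y2 re psiA /=.
    by rewrite -scalerAl mul1r scalerA.
  have [g szg lg] := gen l; rewrite d2 in szg.
  have {}lg : l = g`_0 *: 1 + g`_1 *: x.
    rewrite lg (@horner_coef_wide _ 2) ?size_map_poly // !big_ord_recl big_ord0 addr0.
    by rewrite !coef_map /= expr0 mulr1 expr1 mulr_algl.
  have g01 : g`_0 * g`_1 = 0.
    pose h : {poly k} := (2%:R * (g`_0 * g`_1)) *: 'X + (g`_0 ^+ 2 - g`_1 ^+ 2 - e)%:P.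
    have h0 : h = 0.
      apply: free.
        rewrite d2 (leq_trans (size_polyD _ _)) // geq_max.
        rewrite (leq_trans (size_scale_leq _ _)) ?size_polyX //.
        by rewrite (leq_trans (size_polyC_leq1 _)).
      rewrite rmorphD /= map_polyZ map_polyX map_polyC hornerD hornerZ hornerX hornerC.
      have lE : l = in_alg L g`_0 + in_alg L g`_1 * x by rewrite lg mulr_algl.
      rewrite [LHS](_ : _ = l ^+ 2 - in_alg L e - in_alg L g`_1 ^+ 2 * (x ^+ 2 + 1)).
        by rewrite le subrr x2 addNr mulr0 subrr.
      rewrite lE -[X in _ + X = _]/(in_alg L (g`_0 ^+ 2 - g`_1 ^+ 2 - e)).
      by rewrite !rmorphB !rmorphXn !rmorphM rmorph_nat; ring.
    have := congr1 (fun q : {poly k} => q`_1) h0.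
    rewrite coefD coefZ coefX coefC coef0 mulr1 addr0 => /eqP.
    by rewrite mulf_eq0 (negPf two0) => /eqP.
  move/eqP: g01; rewrite mulf_eq0 => /orP[/eqP g0|/eqP g1].
    have yuz : rho y / rho z = (g`_1 * c2)%:A.
      rewrite yl lg g0 scale0r add0r -[x]mul1r scalerAl rmorphM psiA psix uz.
      by rewrite mulrA mulrK ?A_div // -scalerAl mul1r scalerA.
    have [c _ yzE] := projMV A_div rho_neq0 rhoM y z.
    have /eqP : (y * z^-1 = 1)%g.
      apply: (rho_faithful (c := c * (g`_1 * c2))).
      by rewrite yzE yuz /= -scalerAl mul1r scalerA.
    by rewrite mulg_eq1 invgK => /eqP->; apply: cycle_id.
  have -> : y = 1%g; last exact: group1.
  by apply: (rho_faithful (c := g`_0)); rewrite yl lg g1 scale0r addr0 psiA.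
have pX : (2.-group X)%g by rewrite -p2 (pgroupS sXP).
(* These two subgroups are the kernel and the image of squaring on the abelian [2]-group [X]. *)
rewrite -(mul_card_Ohm_Mho_abelian 1 abX) d2; apply: dvdn_mul.
  rewrite -p2 -oz; apply: cardSg; rewrite /= (OhmE 1 pX) gen_subG.
  by apply/subsetP => y /LdivP[Xy y2]; apply: sqr1.
apply: cardSg; rewrite /= (MhoE 1 pX) gen_subG.
by apply/subsetP => _ /imsetP[y Xy ->]; rewrite -d2 powN.
Qed.

End SylowPart.

(** * The torsion subgroup *)

Section TorsionSubgroup.

Local Open Scope ring_scope.

(** Applied to [X^m - 1], this bounds the scalars by which two lifts of one class may differ, and
    makes the lift of the torsion subgroup finite. *)
Lemma roots_enumerable (F : fieldType) (f : {poly F}) :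
  f != 0 -> exists s : seq F, forall b, root f b -> b \in s.
Proof.
have [m] := ubnP (size f); elim: m f => // m IHm f /ltnSE-lefm f0.
have [[a fa]|nof] := pselect (exists a, root f a); last first.
  by exists [::] => b fb; case: nof; exists b.
have /factor_theorem[g fE] := fa.
have g0 : g != 0 by apply: contraNneq f0 => g0; rewrite fE g0 mul0r.
have [|s sE] := IHm g _ g0.
  apply: leq_trans lefm; rewrite fE size_mul ?polyXsubC_eq0 // size_XsubC addn2 //.
exists (a :: s) => b; rewrite fE rootM root_XsubC inE orbC.
by case/orP => [->|/sE->] //; rewrite orbT.
Qed.

Variables (k : fieldType) (A : falgType k).
Hypothesis A_div : forall x : A, x != 0 -> x \is a GRing.unit.
Variables (gT : finGroupType) (rho : gT -> A).
Hypothesis rho_neq0 : forall x, rho x != 0.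
Hypothesis rhoM : projective_over rho (in_alg A).
Hypothesis rho_faithful : forall x c, rho x = c%:A -> x = 1%g.

(* In this form it is clear that the condition defines a subgroup containing *)
(* all commutators. *)
Definition norm_torsion (x : gT) :=
  exists c j, [/\ c != 0, (0 < j)%N & regnorm (c *: rho x) ^+ j = 1].

(** A power of the lift is a scalar [e], of norm [e ^+ \dim {:A}]. If the norm of the lift is a root
    of unity, then so is [e], and the lift has finite order. *)
Lemma norm_torsionP x :
  norm_torsion x <-> exists c j, [/\ c != 0, (0 < j)%N & (c *: rho x) ^+ j = 1].
Proof.
split=> [] [c [j [c0 j0 xj]]]; last first.
  by exists c, j; split; rewrite // -regnormX xj regnorm1.
have [e xe] : exists e, (c *: rho x) ^+ #|gT| = e%:A.
  have [d _ xd] := projX A_div rho_neq0 rhoM x #|gT|.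
  have [d' r1] := proj_one A_div rho_neq0 rhoM.
  exists (c ^+ #|gT| * (d * d')); rewrite exprZn xd -cardsT expg_cardG ?inE // r1 /=.
  by rewrite -scalerAl mul1r !scalerA mulrA.
have ej : e ^+ (\dim {:A} * j) = 1.
  by rewrite exprM -regnormA -xe regnormX exprAC xj expr1n.
exists c, (#|gT| * (\dim {:A} * j))%N; split=> //.
  by rewrite !muln_gt0 j0 adim_gt0 -cardsT cardG_gt0.
by rewrite exprM xe -[e%:A]/(in_alg A e) -rmorphXn ej rmorph1.
Qed.

Lemma norm_torsion_power (x : gT) d :
  d != 0 -> regnorm (rho x) = d ^+ \dim {:A} -> norm_torsion x.
Proof.
move=> d0 xd; exists d^-1, 1%N; split; rewrite ?invr_eq0 //.
by rewrite expr1 regnormZ xd -exprMn mulVf // expr1n.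
Qed.

Lemma regnorm_proj_neq0 x : regnorm (rho x) != 0.
Proof. by apply: regnorm_neq0; rewrite A_div. Qed.

Lemma regnorm_projM x y : exists2 c, c != 0 &
  regnorm (rho (x * y)%g) = c ^+ \dim {:A} * (regnorm (rho x) * regnorm (rho y)).
Proof.
have [c c0 ->] := projM A_div rho_neq0 rhoM x y; exists c => //=.
by rewrite regnormM regnormA regnormM.
Qed.

(** Up to [\dim {:A}]-th powers of scalars, the norm of the lift is multiplicative with values in a
    commutative group. So the norm of the lift of a commutator, or of a [\dim {:A}]-th power, is a
    [\dim {:A}]-th power in [k]. *)
Lemma torsion_subgroup : exists N : {group gT},
  [/\ forall x, x \in N <-> norm_torsion x, (N <| [set: gT])%g,
      abelian ([set: gT] / N)
    & forall x, (x ^+ \dim {:A})%g \in N].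
Proof.
pose D := \dim {:A}; pose N := [set x | `[< norm_torsion x >]].
have NE x : x \in N <-> norm_torsion x.
  by rewrite inE; split=> [/asboolP|?] //; apply/asboolP.
have gN : group_set N.
  apply/group_setP; split.
    apply/NE; have [d r1] := proj_one A_div rho_neq0 rhoM.
    have d0 : d != 0 by rewrite -(fmorph_eq0 (in_alg A)) -r1.
    by apply: (norm_torsion_power d0); rewrite r1 regnormA.
  move=> x y /NE[c [i [c0 i0 xi]]] /NE[d [j [d0 j0 yj]]]; apply/NE.
  have [e e0 xy] := regnorm_projM x y.
  exists (c * d / e), (i * j)%N; split; first by rewrite !mulf_neq0 ?invr_eq0.
    by rewrite muln_gt0 i0.
  have -> : regnorm (c * d / e *: rho (x * y)%g) = regnorm (c *: rho x) * regnorm (d *: rho y).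
    rewrite !regnormZ xy !exprMn exprVn; have : e ^+ D != 0 by rewrite expf_neq0.
    by move=> eD; field.
  by rewrite exprMn exprM xi expr1n mul1r mulnC exprM yj expr1n.
have derN : ([set: gT]^`(1) \subset group gN)%g.
  rewrite gen_subG; apply/subsetP => _ /imset2P[x y _ _ ->]; apply/NE.
  have [c c0 E1] := regnorm_projM x y; have [d d0 E2] := regnorm_projM y x.
  have [e e0 E3] := regnorm_projM (y * x)%g [~ x, y]%g.
  have [x0 y0] := (regnorm_proj_neq0 x, regnorm_proj_neq0 y).
  apply: (@norm_torsion_power _ (c / (d * e))); first by rewrite !mulf_neq0 ?invr_eq0 ?mulf_neq0.
  move: E3; rewrite -commgC E1 E2 !exprMn exprVn exprMn -/D => E3.
  have [dD eD] : d ^+ D != 0 /\ e ^+ D != 0 by rewrite !expf_neq0.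
  rewrite [LHS](_ : _ = (e ^+ D * (d ^+ D * (regnorm (rho y) * regnorm (rho x))
    * regnorm (rho [~ x, y]%g))) / (d ^+ D * e ^+ D * (regnorm (rho y) * regnorm (rho x)))).
    rewrite -E3; move: (regnorm (rho x)) (regnorm (rho y)) x0 y0 => Nx Ny x0 y0.
    by field; rewrite x0 y0 dD eD.
  move: (regnorm (rho x)) (regnorm (rho y)) x0 y0 => Nx Ny x0 y0.
  by field; rewrite x0 y0 dD eD.
exists (group gN); split=> //.
- exact: sub_der1_normal derN (subsetT _).
- exact: sub_der1_abelian derN.
move=> x; apply/NE; have [c c0 xD] := projX A_div rho_neq0 rhoM x D.
have x0 := regnorm_proj_neq0 x.
apply: (@norm_torsion_power _ (regnorm (rho x) / c)); first by rewrite mulf_neq0 ?invr_eq0.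
have := congr1 (@regnorm _ _) xD; rewrite regnormX /= regnormM regnormA -/D => E.
by rewrite exprMn E exprVn mulrC mulKf // expf_neq0.
Qed.

(** One prime at a time: if [p] divides the order of the quotient, then it divides [n], because the
    exponent divides [n ^ 2]. So [p] is nonzero in [k], and [pgroup_dvd_dim_torsion] bounds the
    image of a Sylow [p]-subgroup, of order [#|P| / #|P :&: N|]. *)
Lemma quotient_torsion_dvd (n : nat) (N : {group gT}) :
    coprime_to_char k n -> \dim {:A} = (n ^ 2)%N ->
    (forall x, x \in N <-> norm_torsion x) -> (N <| [set: gT])%g ->
    (forall x, (x ^+ \dim {:A})%g \in N) ->
  (#|[set: gT] / N|%g %| n ^ 2)%N.
Proof.
move=> n_char dimA NE nN powN; have nNG := normal_norm nN.
apply/dvdn_partP => [|p]; first exact: cardG_gt0.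
rewrite mem_primes => /and3P[p_pr _ p_dvd].
have [P sylP] := Sylow_exists p [set: gT].
have pP := pHall_pgroup sylP; have sPG := subsetT P.
have nNP : P \subset 'N(N)%g := subset_trans sPG nNG.
have pn : (p %| n)%N.
  have [xb /morphimP[x Nx _ xE] ox] := Cauchy p_pr p_dvd.
  have : (p %| n ^ 2)%N.
    rewrite -ox order_dvdn -dimA xE -morphX //; apply/eqP; apply: coset_id.
    exact: powN.
  by rewrite Euclid_dvdX // => /andP[].
have pF : p%:R != 0 :> k.
  by apply: contraL pn => p0; apply: n_char; rewrite inE p_pr.
rewrite -(card_Hall (quotient_pHall nNP sylP)) card_quotient // -indexgI.
have := pgroup_dvd_dim_torsion A_div rho_neq0 rhoM rho_faithful p_pr pF pP nNP.
move=> /(_ (fun x => iff_trans (NE x) (norm_torsionP x))).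
rewrite -(Lagrange (subsetIl P N)) mulnC dvdn_pmul2r ?cardG_gt0 //.
by rewrite dimA.
Qed.

End TorsionSubgroup.

(** * A finite lift of the torsion subgroup *)

Section FiniteLift.

Local Open Scope ring_scope.

Variables (k : fieldType) (A : falgType k).
Hypothesis A_div : forall x : A, x != 0 -> x \is a GRing.unit.
Variables (G : fin_subgroup (proj_unit_group A)).
Variable r : fin_subgroup_elt G -> unit_group A.
Hypothesis rE : forall x, proj_unit (r x) = fin_subgroup_val x.

Lemma unit_val_neq0 (y : unit_group A) : unit_val y != 0.
Proof. by apply: contraTneq (unit_valP y) => ->; rewrite unitr0. Qed.

Lemma proj_unit_eq (y z : unit_group A) :
  proj_unit y = proj_unit z -> exists2 c, c != 0 & unit_val y = c *: unit_val z.
Proof.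
move=> /eqP; rewrite proj_unitP => /scalar_unitP[c c0].
rewrite unit_valM unit_valV => yz; exists c => //.
by rewrite -[LHS](mulrVK (unit_valP z)) yz -scalerAl mul1r.
Qed.

Lemma proj_unitM (y z : unit_group A) : proj_unit (y * z)%g = (proj_unit y * proj_unit z)%g.
Proof. exact: gmulfM. Qed.

Lemma proj_unitV (y : unit_group A) : proj_unit y^-1%g = (proj_unit y)^-1%g.
Proof. exact: gmulfV. Qed.

Lemma lift_projective : projective_over (@unit_val A \o r) (in_alg A).
Proof.
move=> x y; have [|c _ xy] := @proj_unit_eq (r x * r y)%g (r (x * y)%g).
  by rewrite proj_unitM !rE.
by exists c; rewrite /= -scalerAl mul1r -xy.
Qed.

Lemma lift_faithful x c : (@unit_val A \o r) x = c%:A -> x = 1%g.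
Proof.
move=> /= xc; apply: val_inj; rewrite /= -rE.
have /eqP -> // : proj_unit (r x) == proj_unit 1%g.
by rewrite proj_unitP invg1 mulg1 /scalar_unit xc rpredZ ?memv_line.
Qed.

(** The lifts of elements of [N] whose norm is a [J]-th root of unity form a group, onto [N] for a
    suitable common [J]. It is finite because two such lifts of one class differ by a scalar [b]
    with [b ^+ (\dim {:A} * J) = 1]. *)
Lemma finite_torsion_lift (N : {group fin_subgroup_elt G}) :
    (forall x, x \in N <-> norm_torsion (@unit_val A \o r) x) ->
  exists Nt : fin_subgroup (unit_group A), forall a,
    a \in fin_subgroup_set (fin_subgroup_image (@proj_unit k A) Nt)
      <-> exists2 x, x \in N & a = fin_subgroup_val x.
Proof.
move=> NE.
have [c cE] : exists c : fin_subgroup_elt G -> k, forall x,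
    x \in N -> c x != 0 /\ exists2 j, (0 < j)%N & regnorm (c x *: unit_val (r x)) ^+ j = 1.
  apply: (fin_all_exists (P := fun x c => x \in N -> c != 0 /\
    exists2 j, (0 < j)%N & regnorm (c *: unit_val (r x)) ^+ j = 1)) => x.
  have [/NE[d [j [d0 j0 xd]]]|_] := boolP (x \in N); last by exists 0.
  by exists d => _; split=> //; exists j.
have [j jE] : exists j : fin_subgroup_elt G -> nat, forall x, (0 < j x)%N /\
    (x \in N -> regnorm (c x *: unit_val (r x)) ^+ j x = 1).
  apply: (fin_all_exists (P := fun x j => (0 < j)%N /\
    (x \in N -> regnorm (c x *: unit_val (r x)) ^+ j = 1))) => x.
  have [/cE[_ [i i0 xi]]|_] := boolP (x \in N); last by exists 1%N.
  by exists i.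
pose J := (\prod_x j x)%N.
have J0 : (0 < J)%N by rewrite prodn_gt0 // => x; have [] := jE x.
have NJ x : x \in N -> regnorm (c x *: unit_val (r x)) ^+ J = 1.
  move=> Nx; rewrite /J (bigD1 x) //= exprM.
  by rewrite (jE x).2 // expr1n.
pose Q (y : unit_group A) := (exists2 x, x \in N & proj_unit y = fin_subgroup_val x)
  /\ regnorm (unit_val y) ^+ J = 1.
have D0 : (0 < \dim {:A} * J)%N by rewrite muln_gt0 adim_gt0.
have [roots rootsE] : exists s : seq k, forall b, root ('X^(\dim {:A} * J) - 1%:P) b -> b \in s.
  by apply: roots_enumerable; rewrite -size_poly_gt0 size_XnsubC.
(* [insubd] falls back on [1] where the product is not a unit; this is harmless, since [S] only has
   to contain all solutions of [Q] and is filtered afterwards. *)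
pose S : seq (unit_group A) := flatten [seq [seq insubd (1%g : unit_group A)
  ((b * c x) *: unit_val (r x)) | b <- roots] | x <- enum N].
have QS y : Q y -> y \in S.
  move=> [[x Nx yx] yJ]; have [|b b0 yb] := @proj_unit_eq y (r x); first by rewrite rE.
  have [cx0 _] := cE x Nx.
  have bE : b = b / c x * c x by rewrite divfK.
  apply/flatten_mapP; exists x; rewrite ?mem_enum //.
  apply/mapP; exists (b / c x); last first.
    by apply: val_inj; rewrite -bE -yb val_insubd (valP y).
  apply: rootsE; rewrite /root !hornerE subr_eq0; apply/eqP.
  move: yJ; rewrite yb bE -scalerA regnormZ exprMn NJ // mulr1 -exprM.
  by rewrite -bE.
pose Nset : {fset unit_group A} := seq_fset tt [seq y <- S | `[< Q y >]].
have NsetE y : y \in Nset <-> Q y.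
  rewrite seq_fsetE mem_filter; split=> [/andP[/asboolP]|Qy] //.
  by rewrite QS // andbT; apply/asboolP.
have Nset_closed : monoid.group_closed (mem Nset).
  split.
    apply/NsetE; split; last by rewrite regnorm1 expr1n.
    by exists 1%g; rewrite ?group1.
  move=> y z /NsetE[[x Nx yx] yJ] /NsetE[[t Nt zt] zJ]; apply/NsetE.
  split; first by exists (x * t^-1)%g; rewrite ?groupM ?groupV // proj_unitM proj_unitV yx zt.
  rewrite unit_valM unit_valV regnormM exprMn yJ mul1r.
  apply: (mulIf (x := regnorm (unit_val z) ^+ J)); first by rewrite zJ oner_neq0.
  by rewrite -exprMn -regnormM mulVr ?unit_valP // regnorm1 expr1n zJ mulr1.
exists (FinSubgroup Nset_closed) => a; split.
  by case/imfsetP => y /= /NsetE[[t Nt yt] _] ->; exists t.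
case=> x Nx ->; have [cx0 _] := cE x Nx.
have Ux : c x *: unit_val (r x) \is a GRing.unit.
  by rewrite A_div // scaler_eq0 negb_or cx0 unit_val_neq0.
apply/imfsetP; exists (UnitGroup Ux).
  apply/NsetE; split; last exact: NJ.
  exists x => //; apply/eqP; rewrite -rE proj_unitP; apply/scalar_unitP; exists (c x) => //.
  by rewrite unit_valM unit_valV /= -scalerAl mulrV ?unit_valP.
apply/esym/eqP; rewrite -rE proj_unitP; apply/scalar_unitP; exists (c x) => //.
by rewrite unit_valM unit_valV /= -scalerAl mulrV ?unit_valP.
Qed.

End FiniteLift.

(** * The finite subgroup of [A^*] and the abelian quotient *)

Local Open Scope group_scope.

Theorem theorem1p1 (k : fieldType) (n : nat) (A : falgType k)
    (n_gt0 : (0 < n)%N) (n_char : coprime_to_char k n)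
    (A_cd : central_division_algebra A) (A_deg : has_degree A n)
    (G : fin_subgroup (proj_unit_group A)) :
  exists Nt : fin_subgroup (unit_group A),
    let NG := fin_subgroup_image (@proj_unit k A) Nt in
    [/\ (fin_subgroup_set NG `<=` fin_subgroup_set G)%fset,
        rel_subgroup G NG <| [set: fin_subgroup_elt G],
        abelian ([set: fin_subgroup_elt G] / rel_subgroup G NG)
      & (#|[set: fin_subgroup_elt G] / rel_subgroup G NG| %| n ^ 2)%N].
Proof.
have [_ A_div] := A_cd.
have [r rE] : exists r : fin_subgroup_elt G -> unit_group A,
    forall x, proj_unit (r x) = fin_subgroup_val x.
  apply: (fin_all_exists (P := fun x (y : unit_group A) => proj_unit y = fin_subgroup_val x)) => x.
  by exists (generic_quotient.repr (fin_subgroup_val x)); rewrite proj_unitK.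
have r0 x : (@unit_val A \o r) x != 0%R by apply: unit_val_neq0.
have rM := lift_projective rE.
have [N [NE nN abN powN]] := torsion_subgroup A_div r0 rM.
have [Nt NtE] := finite_torsion_lift A_div rE NE.
exists Nt => NG.
have relN : rel_subgroup G NG = N.
  apply/group_inj/setP => x; rewrite inE; apply/idP/idP.
    by move=> /NtE[y Ny /val_inj ->].
  by move=> Nx; apply/NtE; exists x.
rewrite relN; split=> //.
  by apply/fsubsetP => a /NtE[x _ ->]; apply: valP x.
exact: (quotient_torsion_dvd A_div r0 rM (lift_faithful rE) n_char A_deg NE nN powN).
Qed.
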